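(* Let $n,m\in\mathbb N$ with $n\ge 2$, and let $\Gamma\subseteq\mathbb R^n$ be a smooth hypersurface. For every $f\in L^1_{\rm loc}(\mathbb R^{n+m})$ we have $$\mathbf M_{x,y}f \;=\; C_{n,m}\,|r|^{1-n}\,\mathbf M_{y,s}\bigl(|s|^{n-1}\,\mathbf M_x f\bigr)\qquad\text{with}\qquad C_{n,m}:=\frac12\,\frac{|\mathbb S^m|\,|\mathbb S^{n-1}|}{|\mathbb S^{n+m-1}|}.$$
   Context: Points of $\mathbb R^{n+m}\simeq\mathbb R^n\times\mathbb R^m$ are written $(x,y)$ with $x\in\mathbb R^n$, $y\in\mathbb R^m$. $\mathbb S^{k}$ is the unit sphere in $\mathbb R^{k+1}$, $|\mathbb S^k|$ its total surface area, $\mathrm dS$ the surface measure. Subscripts of the operators indicate the variables in which the integration is applied. Definitions: - Spherical Radon transform with cylindrical center-set $\Gamma\times\mathbb R^m$: for $f\in L^1_{\rm loc}(\mathbb R^{n+m})$, the function $\mathbf M_{x,y}f:\Gamma\times\mathbb R^{m+1}\to\mathbb R$ is $$(\mathbf M_{x,y}f)(x,y,r)=\frac1{|\mathbb S^{n+m-1}|}\int_{\mathbb S^{n+m-1}}f\bigl((x,y)+r\omega\bigr)\,\mathrm dS(\omega),\qquad (x,y,r)\in\Gamma\times\mathbb R^m\times\mathbb R.$$ - Partial spherical Radon transform with center-set $\Gamma$: for $f\in L^1_{\rm loc}(\mathbb R^{n+m})$, the function $\mathbf M_xf:\Gamma\times\mathbb R^{m+1}\to\mathbb R$ is $$(\mathbf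 M_x f)(x,y,s)=\frac1{|\mathbb S^{n-1}|}\int_{\mathbb S^{n-1}}f(x+s\omega_1,y)\,\mathrm dS(\omega_1),\qquad (x,y,s)\in\Gamma\times\mathbb R^m\times\mathbb R.$$ - Partial spherical Radon transform with planar center-set in $\mathbb R^{m+1}$: for $h\in L^1_{\rm loc}(\Gamma\times\mathbb R^{m+1})$, the function $\mathbf M_{y,s}h:\Gamma\times\mathbb R^{m+1}\to\mathbb R$ is $$(\mathbf M_{y,s}h)(x,y,r)=\frac1{|\mathbb S^m|}\int_{\mathbb S^m}h\bigl(x,(y,0)+r\sigma\bigr)\,\mathrm dS(\sigma),\qquad (x,y,r)\in\Gamma\times\mathbb R^m\times\mathbb R.$$ The expression $|s|^{n-1}\mathbf M_xf$ denotes the function $(x,y,s)\mapsto|s|^{n-1}(\mathbf M_xf)(x,y,s)$, and $|r|^{1-n}$ denotes multiplication by $|r|^{1-n}$ in the last (radial) variable $r$. *)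

(* Defs.v *)
From HB Require Import structures.
From mathcomp Require Import all_boot all_order all_algebra.
From mathcomp Require Import all_classical all_reals all_analysis measurable_realfun.
Set Implicit Arguments.
Unset Strict Implicit.
Unset Printing Implicit Defensive.
Import Order.TTheory GRing.Theory Num.Theory.
Import numFieldNormedType.Exports.
Local Open Scope classical_set_scope.
Local Open Scope ring_scope.

Definition rV_display : measure_display.
Proof. exact. Qed.

Section measurable_rV.
Context {R : realType} {n : nat}.

Let coors : 'I_n -> 'rV[R]_n -> R := fun i x => x ord0 i.

Let rV_set0 : g_sigma_preimage coors set0.
Proof. exact: sigma_algebra0. Qed.

Let rV_setC A : g_sigma_preimage coors A -> g_sigma_preimage coors (~` A).
Proof. exact: sigma_algebraC. Qed.

Let rV_bigcup (F : _^nat) : (forall i, g_sigma_preimage coors (F i)) ->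
  g_sigma_preimage coors (\bigcup_i (F i)).
Proof. exact: sigma_algebra_bigcup. Qed.

(* The sigma-algebra generated by the coordinates, i.e. the Borel sets. *)
HB.instance Definition _ := @isMeasurable.Build rV_display
  'rV[R]_n (g_sigma_preimage coors) rV_set0 rV_setC rV_bigcup.

Lemma measurable_coord (i : 'I_n) :
  measurable_fun [set: 'rV[R]_n] (fun x : 'rV[R]_n => x ord0 i).
Proof.
move=> _ Y mY; rewrite setTI; apply: sub_sigma_algebra => /=.
rewrite -bigcup_seq/=; exists i => /=; first by rewrite mem_index_enum.
by exists Y => //; rewrite setTI.
Qed.

Lemma measurable_fun_rVP d (T : measurableType d) (f : T -> 'rV[R]_n) :
  measurable_fun [set: T] f <->
  forall i, measurable_fun [set: T] (fun t => f t ord0 i).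
Proof.
split=> [mf i|mf].
  by apply: (measurableT_comp (measurable_coord i)).
have H : g_sigma_preimage coors `<=` [set A | measurable (f @^-1` A)].
  apply: smallest_sub.
    split => /=.
    - by rewrite preimage_set0.
    - by move=> A mA; rewrite setTD -preimage_setC; exact: measurableC.
    - by move=> F mF; rewrite preimage_bigcup; exact: bigcup_measurable.
  rewrite -bigcup_seq/=; apply: bigcup_sub => i _ _ [B mB <-] /=.
  rewrite setTI -comp_preimage -[X in measurable X]setTI.
  exact: (mf i).
by move=> _ A mA; rewrite setTI; exact: H.
Qed.

End measurable_rV.

Section lebesgue_rV.
Context {R : realType}.
Local Open Scope ereal_scope.

Definition cons_rV n (p : measurableTypeR R * 'rV[R]_n) : 'rV[R]_n.+1 :=
  row_mx (p.1%:M : 'rV[R]_1) p.2.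

Lemma measurable_cons_rV n : measurable_fun setT (@cons_rV n).
Proof.
apply/measurable_fun_rVP => i.
case: (@splitP 1 n i) => j ij.
  rewrite (_ : (fun _ => _) = fst); first exact: measurable_fst.
  apply/funext => p.
  have -> : i = lshift n j by exact/val_inj.
  by rewrite /cons_rV [LHS]row_mxEl mxE !ord1 eqxx.
rewrite (_ : (fun _ => _) =
  (fun x : 'rV[R]_n => x ord0 j) \o snd).
  by apply: measurableT_comp => //; exact: measurable_coord.
apply/funext => p; have -> : i = rshift 1 j by exact/val_inj.
by rewrite /cons_rV [LHS]row_mxEr.
Qed.

HB.instance Definition _ n :=
  isMeasurableFun.Build _ _ _ _ (@cons_rV n) (@measurable_cons_rV n).

Section step.
Variables (n : nat) (mu : {sigma_finite_measure set 'rV[R]_n -> \bar R}).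

Definition lebesgue_rVS : set 'rV[R]_n.+1 -> \bar R :=
  pushforward (lebesgue_measure \x mu) (@cons_rV n).

Let lebesgue_rVS0 : lebesgue_rVS set0 = 0.
Proof. exact: measure0. Qed.

Let lebesgue_rVS_ge0 A : 0 <= lebesgue_rVS A.
Proof. exact: measure_ge0. Qed.

Let lebesgue_rVS_sigma_additive : semi_sigma_additive lebesgue_rVS.
Proof. exact: measure_semi_sigma_additive. Qed.

HB.instance Definition _ := isMeasure.Build _ _ _ lebesgue_rVS
  lebesgue_rVS0 lebesgue_rVS_ge0 lebesgue_rVS_sigma_additive.

Let sigma_finite_lebesgue_rVS : sigma_finite setT lebesgue_rVS.
Proof.
have /sigma_finiteP[/= F [FT Fnd Fm]] := sigma_finiteT (@lebesgue_measure R).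
have /sigma_finiteP[/= G [GT Gnd Gm]] := sigma_finiteT mu.
pose u (x : 'rV[R]_n.+1) := x ord0 ord0.
pose v (x : 'rV[R]_n.+1) : 'rV[R]_n := \row_j x ord0 (lift ord0 j).
have mu_ : measurable_fun setT u by exact: measurable_coord.
have mv : measurable_fun setT v.
  apply/measurable_fun_rVP => i.
  rewrite (_ : (fun _ => _) =
    (fun x : 'rV[R]_n.+1 => x ord0 (lift ord0 i))).
    exact: measurable_coord.
  by apply/funext => x; rewrite mxE.
exists (fun k => u @^-1` F k `&` v @^-1` G k).
  apply/seteqP; split => // x _.
  have [i _ Fi] : (\bigcup_i F i) (u x) by rewrite -FT.
  have [j _ Gj] : (\bigcup_i G i) (v x) by rewrite -GT.
  exists (maxn i j) => //; split.
    by apply: (subsetPset _ _ (Fnd i (maxn i j) _)) => //; exact: leq_maxl.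
  by apply: (subsetPset _ _ (Gnd j (maxn i j) _)) => //; exact: leq_maxr.
move=> k; have [mF Foo] := Fm k; have [mG Goo] := Gm k.
split.
  by apply: measurableI; rewrite -[X in measurable X]setTI; [exact: mu_|exact: mv].
rewrite /lebesgue_rVS /pushforward.
rewrite (_ : _ @^-1` _ = F k `*` G k).
  by rewrite product_measure1E// lte_mul_pinfty// ge0_fin_numE.
apply/seteqP.
have uE p : u (cons_rV p) = p.1.
  rewrite /u /cons_rV (_ : ord0 = lshift n (ord0 : 'I_1)); last exact/val_inj.
  by rewrite [LHS]row_mxEl mxE eqxx.
have vE p : v (cons_rV p) = p.2.
  apply/rowP => j; rewrite /v /cons_rV mxE.
  rewrite (_ : lift ord0 j = rshift 1 j); last exact/val_inj.
  by rewrite [LHS]row_mxEr.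
by split=> p /=; rewrite uE vE.
Qed.

HB.instance Definition _ := Measure_isSigmaFinite.Build _ _ _ lebesgue_rVS
  sigma_finite_lebesgue_rVS.

End step.

Fixpoint lebesgue_rV n : {sigma_finite_measure set 'rV[R]_n -> \bar R} :=
  match n with
  | 0 => \d_(0%R : 'rV[R]_0)
  | k.+1 => lebesgue_rVS (lebesgue_rV k)
  end.

End lebesgue_rV.
Arguments lebesgue_rV {R} n.

Section sphere.
Context {R : realType}.

(* The library's norm on 'rV[R]_n is the sup norm. *)
Definition enorm n (x : 'rV[R]_n) : R := Num.sqrt (\sum_i x ord0 i ^+ 2).

(* The unit sphere S^(n-1) of R^n, indexed by the ambient dimension. *)
Definition sphere n : set 'rV[R]_n := [set w | enorm w = 1].

Lemma measurable_enorm n :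
  measurable_fun setT (fun x : 'rV[R]_n => enorm x).
Proof.
apply: (measurableT_comp (continuous_measurable_fun (@sqrt_continuous R))).
apply: measurable_sum => i.
by apply: measurable_funX; exact: measurable_coord.
Qed.

Lemma measurable_normalize n :
  measurable_fun setT (fun x : 'rV[R]_n => (enorm x)^-1 *: x).
Proof.
apply/measurable_fun_rVP => i.
rewrite (_ : (fun _ => _) = (fun x : 'rV[R]_n => enorm x `^ (-1) * x ord0 i)).
  apply: measurable_funM; last exact: measurable_coord.
  exact: (measurableT_comp (measurable_powR (-1 : R)) (@measurable_enorm n)).
by apply/funext => x; rewrite mxE powR_inv1// sqrtr_ge0.
Qed.

Section surface_measure.
Variable n : nat.
Local Open Scope ereal_scope.

(* The part in the closed unit ball of the cone over A, without its apex. *)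
Definition unit_cone (A : set 'rV[R]_n) : set 'rV[R]_n :=
  [set x | (0 < enorm x <= 1)%R /\ A ((enorm x)^-1 *: x)%R].

(* The surface measure of the unit sphere, as a measure on R^n concentrated on
   the sphere: S(A) is n times the volume of the cone over A, as in polar
   coordinates dx = r^(n-1) dr dS. For n = 1 it is the counting measure of
   {-1, 1}. *)
Definition surface_measure (A : set 'rV[R]_n) : \bar R :=
  n%:R%:E * lebesgue_rV n (unit_cone A).

Lemma measurable_unit_cone A : measurable A -> measurable (unit_cone A).
Proof.
move=> mA.
rewrite (_ : unit_cone A = @enorm n @^-1` `]0%R, 1%R] `&`
    (fun x => (enorm x)^-1 *: x)%R @^-1` A); last first.
  by apply/seteqP; split=> x /=; rewrite in_itv.
apply: measurableI; rewrite -[X in measurable X]setTI.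
  exact: measurable_enorm.
exact: measurable_normalize.
Qed.

Let surface_measure0 : surface_measure set0 = 0.
Proof.
rewrite /surface_measure (_ : unit_cone set0 = set0) ?measure0 ?mule0//.
by apply/seteqP; split=> x [].
Qed.

Let surface_measure_ge0 A : 0 <= surface_measure A.
Proof. by rewrite mule_ge0. Qed.

Let surface_measure_sigma_additive : semi_sigma_additive surface_measure.
Proof.
move=> F mF tF mUF.
have UE : unit_cone (\bigcup_i F i) = \bigcup_i unit_cone (F i).
  apply/seteqP; split=> x /=.
    by move=> [x1 [i _ Fi]]; exists i.
  by move=> [i _ [x1 Fi]]; split => //; exists i.
have := @measure_semi_sigma_additive _ _ _
  (mscale (n%:R : R)%:nng%R (lebesgue_rV n)) (unit_cone \o F).
rewrite /surface_measure UE; apply.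
- by move=> i; exact: measurable_unit_cone.
- apply/trivIsetP => i j _ _ ij; apply/seteqP; split=> // x [[_ Fi] [_ Fj]].
  move/trivIsetP : tF => /(_ i j Logic.I Logic.I ij)/seteqP[+ _].
  by move/(_ ((enorm x)^-1 *: x)%R); exact.
- by rewrite -UE; exact: measurable_unit_cone.
Qed.

HB.instance Definition _ := isMeasure.Build _ _ _ surface_measure
  surface_measure0 surface_measure_ge0 surface_measure_sigma_additive.

End surface_measure.

(* |S^(n-1)| *)
Definition sphere_area n : R := fine (surface_measure (@sphere n)).

End sphere.
Arguments surface_measure {R} n.
Arguments sphere {R} n.
Arguments sphere_area {R} n.

Section integrability.
Context {R : realType}.

Definition locally_integrable_rV n (f : 'rV[R]_n -> R) :=
  measurable_fun setT f /\
  forall K, compact K -> (\int[lebesgue_rV n]_(x in K) `|f x|%:E < +oo)%E.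

(* Measurability in the library is Borel measurability; the a.e. modification
   allows every Lebesgue measurable representative. *)
Definition L1loc n (f : 'rV[R]_n -> R) :=
  exists2 g, locally_integrable_rV g & {ae lebesgue_rV n, forall x, f x = g x}.

(* Integrability with respect to the completion of mu. The library's integral
   of such an f is that of g, even if f itself is not measurable. *)
Definition ae_integrable d (T : measurableType d)
    (mu : {measure set T -> \bar R}) (D : set T) (f : T -> R) :=
  exists2 g, mu.-integrable D (EFin \o g) &
             {ae mu, forall t, D t -> f t = g t}.

End integrability.

Section hypersurface.
Context {R : realType} {n : nat}.
Implicit Types (U G : set 'rV[R]_n) (phi : 'rV[R]_n -> R).

Fixpoint Ck k U phi : Prop :=
  match k with
  | 0 => forall x, U x -> {for x, continuous phi}
  | k'.+1 => (forall x, U x -> differentiable phi x) /\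
             forall i, Ck k' U ('D_(delta_mx ord0 i) phi)
  end.

Definition smooth_on U phi := forall k, Ck k U phi.

Definition smooth_hypersurface G := forall p, G p ->
  exists U phi, [/\ open U, U p, smooth_on U phi,
    exists v, 'D_v phi p != 0 & G `&` U = [set x | U x /\ phi x = 0]].

End hypersurface.

(* The means below are total functions; where the defining integral does not
   converge, i.e. where the matching _defined predicate fails, the value is a
   dummy. *)
Section spherical_means.
Context {R : realType} {n m : nat}.
Implicit Types (f : 'rV[R]_(n + m) -> R) (h : 'rV[R]_n -> 'rV[R]_m -> R -> R).
Implicit Types (x : 'rV[R]_n) (y : 'rV[R]_m) (r s : R).

Definition Mxy_integrand f x y r (w : 'rV[R]_(n + m)) : R :=
  f (row_mx x y + r *: w).

Definition Mxy f x y r : R :=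
  (sphere_area (n + m))^-1 *
  \int[surface_measure (n + m)]_(w in sphere (n + m)) Mxy_integrand f x y r w.

Definition Mxy_defined f x y r :=
  ae_integrable (surface_measure (n + m)) (sphere (n + m))
    (Mxy_integrand f x y r).

Definition Mx_integrand f x y s (w : 'rV[R]_n) : R :=
  f (row_mx (x + s *: w) y).

Definition Mx f x y s : R :=
  (sphere_area n)^-1 *
  \int[surface_measure n]_(w in sphere n) Mx_integrand f x y s w.

Definition Mx_defined f x y s :=
  ae_integrable (surface_measure n) (sphere n) (Mx_integrand f x y s).

(* A point (y, s) of R^m x R is represented as row_mx y s%:M in R^(m+1). *)
Definition Mys_integrand h x y r (w : 'rV[R]_(m + 1)) : R :=
  let z := row_mx y 0 + r *: w in h x (lsubmx z) (rsubmx z ord0 ord0).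

Definition Mys h x y r : R :=
  (sphere_area (m + 1))^-1 *
  \int[surface_measure (m + 1)]_(w in sphere (m + 1)) Mys_integrand h x y r w.

Definition Mys_defined h x y r :=
  ae_integrable (surface_measure (m + 1)) (sphere (m + 1))
    (Mys_integrand h x y r).

End spherical_means.

Definition Cnm (R : realType) (n m : nat) : R :=
  1 / 2 * (sphere_area (m + 1) * sphere_area n / sphere_area (n + m)).

(* Main.v *)
Require Import Defs.
From HB Require Import structures.
From mathcomp Require Import all_boot all_order all_algebra.
From mathcomp Require Import all_classical all_reals all_analysis.
From mathcomp Require Import measurable_realfun ring lra.
Import Order.TTheory GRing.Theory Num.Theory.
Import numFieldNormedType.Exports.
Set Implicit Arguments.
Unset Strict Implicit.
Unset Printing Implicit Defensive.
Local Open Scope classical_set_scope.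
Local Open Scope ring_scope.

(** The sphere S^(n+m-1) is fibred by the spheres S^(n-1): a point of it is
cyl s w = (s0 w, v) with w in S^(n-1) and s = (v, s0) in S^m, and since
(v, s0, w) and (v, - s0, - w) give the same point, every point off the axis R^m
is reached exactly twice. In these coordinates the surface measure is
1/2 |s0|^(n-1) dS(s) dS(w), so for F integrable on the sphere

  2 int F dS = int_(s in S^m) |s0|^(n-1) int_(w in S^(n-1)) F (cyl s w)

([integral_fibration] for nonnegative F, [Rintegral_fibration] in general).
Applied to F(z) = f ((x, y) + r z), the inner integral is |S^(n-1)| times the
mean of f over the sphere about x of radius r |s0| in the slice at height
y + r v; this is M_x f at the point (y, 0) + r s, at which the weight of the
theorem is |r s0|^(n-1) = |r|^(n-1) |s0|^(n-1). The identity follows by dividing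
by the areas of the spheres, and it holds for every single r != 0 for which f is
integrable on the sphere of radius r about (x, y).

The fibration formula is derived from polar coordinates. With the surface
measure defined by volumes of cones, polar coordinates ([integral_polar]) reduce
to Tonelli and linear changes of variables. In the first n of the n + m
variables they give cylindrical coordinates ([integral_cylindrical]). Applied to
functions supported in the unit ball, these and the polar coordinates of
R^(m+1) yield the fibration.

The almost everywhere statements come from the same formulas, which express an
integral over R^N as an iterated one: a null set meets almost every slice in a
null set, and an integrable function is integrable on almost every slice
([ae_slice_ae], [ae_slice_lty], [L1loc_slice]). As f is only almost everywhere
equal to a Borel function, its means are compared with those of the Borel
representative through [integral_ae_representative]. *)

(** * Tonelli and measurability *)

Section Tonelli_curried.
Context {d1 d2 : measure_display} {T1 : measurableType d1}
  {T2 : measurableType d2} {R : realType}.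
Local Open Scope ereal_scope.
Implicit Types F : T1 -> T2 -> \bar R.

Lemma measurable_integral2 (m2 : {sigma_finite_measure set T2 -> \bar R}) F :
  measurable_fun setT (fun p : T1 * T2 => F p.1 p.2) ->
  (forall x y, 0 <= F x y) -> measurable_fun setT (fun x => \int[m2]_y F x y).
Proof.
move=> mF F0.
exact: (measurable_fun_fubini_tonelli_F (m2 := m2)
  (fun p : T1 * T2 => F p.1 p.2)).
Qed.

Lemma tonelli (m1 : {sigma_finite_measure set T1 -> \bar R})
    (m2 : {sigma_finite_measure set T2 -> \bar R}) F :
  measurable_fun setT (fun p : T1 * T2 => F p.1 p.2) ->
  (forall x y, 0 <= F x y) ->
  \int[m1]_x \int[m2]_y F x y = \int[m2]_y \int[m1]_x F x y.
Proof.
move=> mF F0.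
exact: (fubini_tonelli (m1 := m1) (m2 := m2) (fun p : T1 * T2 => F p.1 p.2)).
Qed.

End Tonelli_curried.

Lemma tonelli_lebesgue {R : realType} {d : measure_display}
    {T : measurableType d} (m : {sigma_finite_measure set T -> \bar R})
    (F : R -> T -> \bar R) :
  measurable_fun setT (fun p : R * T => F p.1 p.2) ->
  (forall t y, 0 <= F t y)%E ->
  (\int[@lebesgue_measure R]_t \int[m]_y F t y =
   \int[m]_y \int[@lebesgue_measure R]_t F t y)%E.
Proof.
exact: (@tonelli _ _ (measurableTypeR R) T R (@lebesgue_measure R) m F).
Qed.

Lemma measurable_integral_lebesgue {R : realType} {d : measure_display}
    {T : measurableType d} (F : R -> T -> \bar R) :
  measurable_fun setT (fun p : R * T => F p.1 p.2) ->
  (forall t y, 0 <= F t y)%E ->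
  measurable_fun setT (fun y => \int[@lebesgue_measure R]_t F t y)%E.
Proof.
move=> mF F0.
exact: (@measurable_fun_fubini_tonelli_G _ _ (measurableTypeR R) T R
  (@lebesgue_measure R) (fun p => F p.1 p.2)).
Qed.

Section measurability.
Context {R : realType} {d : measure_display} {T : measurableType d}.

Lemma measurable_fun_coord n (u : T -> 'rV[R]_n) i :
  measurable_fun setT u -> measurable_fun setT (fun t => u t ord0 i).
Proof. by move=> mu; apply: (measurableT_comp (measurable_coord i)). Qed.

Lemma measurable_row_mx n m (u : T -> 'rV[R]_n) (v : T -> 'rV[R]_m) :
  measurable_fun setT u -> measurable_fun setT v ->
  measurable_fun setT (fun t => row_mx (u t) (v t)).
Proof.
move=> mu mv; apply/measurable_fun_rVP => i.
case: (@splitP n m i) => j ij.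
  have -> : i = lshift m j by exact/val_inj.
  under eq_fun do rewrite row_mxEl.
  exact: measurable_fun_coord.
have -> : i = rshift n j by exact/val_inj.
under eq_fun do rewrite row_mxEr.
exact: measurable_fun_coord.
Qed.

Lemma measurable_scale_rV n (a : T -> R) (u : T -> 'rV[R]_n) :
  measurable_fun setT a -> measurable_fun setT u ->
  measurable_fun setT (fun t => a t *: u t).
Proof.
move=> ma mu; apply/measurable_fun_rVP => i.
under eq_fun do rewrite mxE.
by apply: measurable_funM => //; exact: measurable_fun_coord.
Qed.

Lemma measurable_add_rV n (u v : T -> 'rV[R]_n) :
  measurable_fun setT u -> measurable_fun setT v ->
  measurable_fun setT (fun t => u t + v t).
Proof.
move=> mu mv; apply/measurable_fun_rVP => i.
under eq_fun do rewrite mxE.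
by apply: measurable_funD => //; exact: measurable_fun_coord.
Qed.

Lemma measurable_lsubmx n m (u : T -> 'rV[R]_(n + m)) :
  measurable_fun setT u -> measurable_fun setT (fun t => lsubmx (u t)).
Proof.
move=> mu; apply/measurable_fun_rVP => i.
under eq_fun do rewrite mxE.
exact: measurable_fun_coord.
Qed.

Lemma measurable_last_coord m (u : T -> 'rV[R]_(m + 1)) :
  measurable_fun setT u ->
  measurable_fun setT (fun t => rsubmx (u t) ord0 ord0).
Proof.
move=> mu; under eq_fun do rewrite mxE.
exact: measurable_fun_coord.
Qed.

Lemma measurable_scalar_rV1 (a : T -> R) : measurable_fun setT a ->
  measurable_fun setT (fun t => (a t)%:M : 'rV[R]_1).
Proof.
move=> ma; apply/measurable_fun_rVP => i.
rewrite (_ : (fun _ => _) = a) //; apply/funext => t.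
by rewrite mxE (ord1 i) eqxx.
Qed.

Lemma measurable_bool_EFin (b : T -> bool) : measurable_fun setT b ->
  measurable_fun setT (fun t => ((b t)%:R : R)%:E).
Proof.
move=> mb; apply/measurable_EFinP.
rewrite (_ : (fun _ => _) = \1_[set t | b t]).
  apply: measurable_indic; rewrite -[X in measurable X]setTI.
  exact: (mb measurableT [set true]).
apply/funext => t; rewrite indicE.
case: (boolP (b t)) => [bt|/negP bt]; first by rewrite mem_set.
by rewrite memNset.
Qed.

End measurability.

(** * Lebesgue measure on R^n *)

Section affine_1D.
Context {R : realType}.
Local Notation leb := (@lebesgue_measure R).
Local Open Scope ereal_scope.

Lemma measurable_affine (a c : R) :
  measurable_fun setT
    (fun t : measurableTypeR R => (c + a * t)%R : measurableTypeR R).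
Proof. by apply: measurable_funD => //; exact: measurable_funM. Qed.

(** Lebesgue measure is determined by its values on the intervals ]x, y]; a
nonzero factor [a] scales the length of their preimages by 1 / |a|. *)
Lemma ge0_integral_affine (a c : R) (G : R -> \bar R) : a != 0%R ->
  measurable_fun setT G -> (forall t, 0 <= G t) ->
  \int[leb]_t G t = `|a|%:E * \int[leb]_t G (c + a * t)%R.
Proof.
move=> a0 mG G0.
pose phi (t : measurableTypeR R) := (c + a * t)%R : measurableTypeR R.
have mphi : measurable_fun setT phi by exact: measurable_affine.
have a0' : (0 <= `|a|)%R by [].
pose nu := mscale (NngNum a0')
  (measure_function_pushforward__canonical__measure_function_Measure leb mphi).
have leb_nu A : measurable A -> leb A = nu A.
  move: A; apply: lebesgue_measure_unique => _ [[x y] _ <-] /=.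
  rewrite /nu /mscale/= /pushforward.
  have [a_gt0|a_lt0|a_eq0] := ltgtP 0%R a; last by rewrite a_eq0 eqxx in a0.
    rewrite (_ : _ @^-1` _ =
        `]((x - c) / a)%R, ((y - c) / a)%R]%classic); last first.
      apply/seteqP; split => t /=; rewrite !in_itv/= ltr_pdivrMr//
        ler_pdivlMr//; by rewrite ltrBlDl lerBrDl (mulrC t).
    rewrite !lebesgue_measure_itv/= !lte_fin ltr_pM2r ?invr_gt0// ltrD2r.
    case: ifPn => _; last by rewrite mule0.
    rewrite -!EFinD -EFinM gtr0_norm// -mulrBl mulrCA divff ?mulr1//.
    by congr (_%:E); ring.
  (* A negative factor reverses the interval, hence moves the closed end. *)
  rewrite (_ : _ @^-1` _ =
      `[((y - c) / a)%R, ((x - c) / a)%R[%classic); last first.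
    apply/seteqP; split => t /=; rewrite !in_itv/= ltr_ndivlMr// ler_ndivrMr//;
      by rewrite ltrBlDl lerBrDl (mulrC t) => /andP[-> ->].
  rewrite !lebesgue_measure_itv/= !lte_fin ltr_nM2r ?invr_lt0// ltrD2r.
  case: ifPn => _; last by rewrite mule0.
  rewrite -!EFinD -EFinM ltr0_norm// -mulrBl mulrCA mulNr
    divff ?lt_eqF// mulrN1.
  by congr (_%:E); ring.
rewrite (eq_measure_integral nu); last by move=> A mA _; exact: leb_nu.
rewrite ge0_integral_mscale//= ge0_integral_pushforward//=.
Qed.

End affine_1D.

Section lebesgue_rV_theory.
Context {R : realType}.
Local Notation leb := (@lebesgue_measure R).
Local Open Scope ereal_scope.

Lemma measurable_consE d (T : measurableType d) n (t : T -> R)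
    (u : T -> 'rV[R]_n) :
  measurable_fun setT t -> measurable_fun setT u ->
  measurable_fun setT (fun x => cons_rV (t x, u x)).
Proof.
move=> mt mu.
apply: (measurableT_comp (@measurable_cons_rV R n)).
exact: measurable_fun_pair.
Qed.

Lemma integral_rVS n (G : 'rV[R]_n.+1 -> \bar R) :
  measurable_fun setT G -> (forall z, 0 <= G z) ->
  \int[lebesgue_rV n.+1]_z G z =
  \int[leb]_t \int[lebesgue_rV n]_u G (cons_rV (t, u)).
Proof.
move=> mG G0.
rewrite [LHS](_ : _ =
  \int[pushforward (leb \x lebesgue_rV n) (@cons_rV R n)]_z G z)//.
rewrite ge0_integral_pushforward//=.
rewrite preimage_setT fubini_tonelli1//.
apply: measurableT_comp => //.
Qed.


Lemma cons_rV_surj n (z : 'rV[R]_n.+1) : exists t u, z = cons_rV (t, u).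
Proof.
exists ((lsubmx (z : 'rV[R]_(1 + n))) ord0 ord0), (rsubmx (z : 'rV[R]_(1 + n))).
by rewrite /cons_rV/= -mx11_scalar hsubmxK.
Qed.

Lemma cons_rVD n (s t : R) (u v : 'rV[R]_n) :
  (cons_rV (s, u) + cons_rV (t, v))%R = cons_rV ((s + t)%R, (u + v)%R).
Proof.
by rewrite /cons_rV/= raddfD/=; exact: (add_row_mx (s%:M : 'rV_1) u t%:M v).
Qed.

Lemma cons_rVZ n (a t : R) (u : 'rV[R]_n) :
  (a *: cons_rV (t, u))%R = cons_rV ((a * t)%R, (a *: u)%R).
Proof.
rewrite /cons_rV/= -scale_scalar_mx.
exact: (scale_row_mx a (t%:M : 'rV_1) u).
Qed.

Lemma row_mx_cons_rV n m (t : R) (u : 'rV[R]_n) (v : 'rV[R]_m) :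
  row_mx (cons_rV (t, u)) v = cons_rV (t, row_mx u v).
Proof.
rewrite /cons_rV/=; apply/rowP => i.
have /= := @row_mxA _ 1 1 n m (t%:M : 'rV[R]_1) u v.
move/(congr1 (fun M : 'rV[R]_(1 + (n + m)) => M ord0 i)).
rewrite castmxE/= => ->.
by congr (_ _ _); exact/val_inj.
Qed.

Lemma cons_rV0E n (t : R) (u : 'rV[R]_n) : cons_rV (t, u) ord0 ord0 = t.
Proof.
rewrite /cons_rV/= (_ : ord0 = lshift n (ord0 : 'I_1)); last exact/val_inj.
by rewrite [LHS]row_mxEl mxE eqxx.
Qed.

Lemma cons_rVSE n (t : R) (u : 'rV[R]_n) i :
  cons_rV (t, u) ord0 (lift ord0 i) = u ord0 i.
Proof.
rewrite /cons_rV/= (_ : lift ord0 i = rshift 1 i); last exact/val_inj.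
by rewrite [LHS]row_mxEr.
Qed.

Lemma integral_rV0 (G : 'rV[R]_0 -> \bar R) : measurable_fun setT G ->
  \int[lebesgue_rV 0]_z G z = G 0%R.
Proof. by move=> mG; rewrite integral_dirac// diracT mul1e. Qed.

Lemma integral_rV1 (G : 'rV[R]_1 -> \bar R) :
  measurable_fun setT G -> (forall z, 0 <= G z) ->
  \int[lebesgue_rV 1]_z G z = \int[leb]_t G t%:M.
Proof.
move=> mG G0; rewrite integral_rVS//; apply: eq_integral => t _.
rewrite integral_rV0; last first.
  apply: measurableT_comp => //; exact: measurable_consE.
congr G; apply/rowP => i; rewrite (ord1 i) cons_rV0E.
by rewrite mxE eqxx.
Qed.

(** Like the next two lemmas, this peels off one coordinate at a time, so only
the one-dimensional change of variables is needed. *)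
Lemma integral_translation n (c : 'rV[R]_n) (G : 'rV[R]_n -> \bar R) :
  measurable_fun setT G -> (forall z, 0 <= G z) ->
  \int[lebesgue_rV n]_z G (c + z)%R = \int[lebesgue_rV n]_z G z.
Proof.
elim: n c G => [|n IH] c G mG G0.
  by apply: eq_integral => z _; rewrite (thinmx0 c) add0r.
have mGc : measurable_fun setT (fun z => G (c + z)%R).
  by apply: (measurableT_comp mG); apply: measurable_add_rV.
rewrite (integral_rVS mGc) ?(integral_rVS mG G0); last first.
  by move=> z; exact: G0.
have [c0 [c' ->]] := cons_rV_surj c.
have mH : measurable_fun setT
    (fun t => \int[lebesgue_rV n]_u G (cons_rV (t, u))).
  apply: (@measurable_integral2 _ _ _ _ _ _
    (fun t u => G (cons_rV (t, u)))) => //.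
  by apply: (measurableT_comp mG); apply: measurable_consE.
rewrite [RHS](ge0_integral_affine c0 (oner_neq0 R))//; last first.
  by move=> t; exact: integral_ge0.
rewrite normr1 mul1e; apply: eq_integral => t _; rewrite mul1r.
rewrite -[RHS](IH c'); last 2 first.
- by apply: (measurableT_comp mG); exact: measurable_consE.
- by move=> z; exact: G0.
by apply: eq_integral => u _; rewrite cons_rVD.
Qed.

(** [a] may be negative; [a = -1] is the invariance under reflection. *)
Lemma integral_scaling n (a : R) (G : 'rV[R]_n -> \bar R) : a != 0%R ->
  measurable_fun setT G -> (forall z, 0 <= G z) ->
  \int[lebesgue_rV n]_z G z =
    (`|a| ^+ n)%:E * \int[lebesgue_rV n]_z G (a *: z)%R.
Proof.
move=> a0; elim: n G => [|n IH] G mG G0.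
  rewrite expr0 mul1e.
  by apply: eq_integral => z _; rewrite (thinmx0 z) scaler0.
have mGa : measurable_fun setT (fun z : 'rV[R]_n.+1 => G (a *: z)%R).
  by apply: (measurableT_comp mG); apply: measurable_scale_rV.
rewrite integral_rVS// integral_rVS//.
pose H (t : R) := \int[lebesgue_rV n]_u G (cons_rV (t, (a *: u)%R)).
have mH : measurable_fun setT H.
  apply: (@measurable_integral2 _ _ _ _ _ _
    (fun (t : R) (u : 'rV[R]_n) => G (cons_rV (t, (a *: u)%R)))) => //.
  apply: (measurableT_comp mG); apply: measurable_consE => //.
  exact: measurable_scale_rV.
have H0 t : 0 <= H t by exact: integral_ge0.
transitivity (\int[leb]_t ((`|a| ^+ n)%:E * H t)).
  apply: eq_integral => t _.
  by rewrite IH//; apply: (measurableT_comp mG); exact: measurable_consE.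
rewrite ge0_integralZl; [|by []|exact: mH|by []|
  by rewrite lee_fin exprn_ge0].
rewrite [X in _ * X = _](ge0_integral_affine 0 a0 mH H0).
rewrite muleA -EFinM -exprSr; congr (_ * _).
apply: eq_integral => t _; apply: eq_integral => u _.
by rewrite cons_rVZ add0r.
Qed.

Lemma integral_row_mx n m (G : 'rV[R]_(n + m) -> \bar R) :
  measurable_fun setT G -> (forall z, 0 <= G z) ->
  \int[lebesgue_rV (n + m)]_z G z =
  \int[lebesgue_rV n]_u \int[lebesgue_rV m]_v G (row_mx u v).
Proof.
have mint k (F : 'rV[R]_(k + m) -> \bar R) :
    measurable_fun setT F -> (forall z, 0 <= F z) ->
    measurable_fun setT (fun u => \int[lebesgue_rV m]_v F (row_mx u v)).
  move=> mF F0.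
  apply: (@measurable_integral2 _ _ _ _ _ _ (fun u v => F (row_mx u v))) => //.
  by apply: (measurableT_comp mF); exact: measurable_row_mx.
elim: n G => [|n IH] G mG G0.
  rewrite integral_rV0//; last exact: mint.
  by apply: eq_integral => v _; rewrite row_thin_mx.
rewrite [LHS](@integral_rVS (n + m))// integral_rVS//; last 2 first.
  exact: mint.
  by move=> u; exact: integral_ge0.
apply: eq_integral => t _; rewrite IH; last 2 first.
- by apply: (measurableT_comp mG); exact: measurable_consE.
- by move=> z; exact: G0.
apply: eq_integral => u _; apply: eq_integral => v _.
by rewrite row_mx_cons_rV.
Qed.

Lemma measurable_box n (I : set R) : measurable I ->
  measurable [set z : 'rV[R]_n | forall i, I (z ord0 i)].
Proof.
move=> mI.
rewrite (_ : [set _ | _] = \bigcap_(i in [set: 'I_n])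
    ((fun z : 'rV[R]_n => z ord0 i) @^-1` I)); last first.
  by apply/seteqP; split => z /= zI i => [_|]; exact: zI.
apply: fin_bigcap_measurable => // i _.
rewrite -[X in measurable X]setTI; exact: measurable_coord.
Qed.

(** Cubes inscribed in and circumscribed about the unit ball show that its
volume is positive and finite. *)
Lemma lebesgue_rV_box n (I : set R) (r : R) : measurable I ->
  leb I = r%:E ->
  lebesgue_rV n [set z : 'rV[R]_n | forall i, I (z ord0 i)] = (r ^+ n)%:E.
Proof.
move=> mI Ir; elim: n => [|n IH].
  by rewrite expr0/= diracE mem_set// => -[].
have mB := @measurable_box n I mI.
transitivity ((leb \x lebesgue_rV n)
    (I `*` [set z : 'rV[R]_n | forall i, I (z ord0 i)])); last first.
  have -> := product_measure1E leb (lebesgue_rV n) mI mB.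
  by rewrite [X in X * _]Ir [X in _ * X]IH -EFinM exprS.
suff <- : @cons_rV R n @^-1` [set z | forall i, I (z ord0 i)] =
    I `*` [set z : 'rV[R]_n | forall i, I (z ord0 i)] by [].
apply/seteqP; split => -[t u] /=.
  move=> H; split; first by have := H ord0; rewrite cons_rV0E.
  by move=> i; have := H (lift ord0 i); rewrite cons_rVSE.
move=> [It Iu] i; have [->|[j ->]] : i = ord0 \/ exists j, i = lift ord0 j.
- by case: (unliftP ord0 i) => [j ->|->]; [right; exists j|left].
- by rewrite cons_rV0E.
- by rewrite cons_rVSE.
Qed.

Lemma lebesgue_rV_hyperplane n :
  lebesgue_rV n.+1 [set z : 'rV[R]_n.+1 | z ord0 ord0 = 0%R] = 0.
Proof.
have E := product_measure1E leb (lebesgue_rV n)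
  (measurable_set1 (0%R : R)) measurableT.
have leb0 : leb [set 0%R] = 0 by exact: lebesgue_measure_set1.
rewrite [X in X * _]leb0 mul0e in E; rewrite -[RHS]E.
suff <- : @cons_rV R n @^-1` [set z | z ord0 ord0 = 0%R] =
    [set 0%R] `*` setT by [].
by apply/seteqP; split => -[t u] /=; rewrite cons_rV0E// => -[].
Qed.

End lebesgue_rV_theory.

(** * The Euclidean norm *)

Section measurability_tactic.
Context {R : realType} {d : measure_display} {T : measurableType d}.

Lemma measurable_fun_enorm n (u : T -> 'rV[R]_n) :
  measurable_fun setT u -> measurable_fun setT (fun t => enorm (u t)).
Proof. by move=> mu; apply: (measurableT_comp (@measurable_enorm R n)). Qed.

Lemma measurable_fun_normr (a : T -> R) :
  measurable_fun setT a -> measurable_fun setT (fun t => `|a t|).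
Proof. by move=> ma; apply: measurableT_comp. Qed.

Lemma measurable_inv_ge0 (a : T -> R) : (forall t, 0 <= a t) ->
  measurable_fun setT a -> measurable_fun setT (fun t => (a t)^-1).
Proof.
move=> a0 ma; rewrite (_ : (fun _ => _) = (fun t => a t `^ (-1))).
  exact: (measurableT_comp (measurable_powR (-1 : R)) ma).
by apply/funext => t; rewrite powR_inv1.
Qed.

End measurability_tactic.

Lemma enorm_ge0 {R : realType} n (z : 'rV[R]_n) : 0 <= enorm z.
Proof. exact: sqrtr_ge0. Qed.

Ltac measurability_step :=
  match goal with
  | |- measurable_fun _ (fun _ => ?c) => exact: measurable_cst
  | |- measurable_fun _ (fun x => x) => exact: measurable_id
  | |- measurable_fun _ (fun x => x.1) => exact: measurable_fst
  | |- measurable_fun _ (fun x => x.2) => exact: measurable_snd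
  | H : ?P |- ?P => exact: H
  | |- measurable_fun _ (fun x => (_ * _)%E) => apply: emeasurable_funM
  | |- measurable_fun _ (fun x => ((nat_of_bool _)%:R)%:E) =>
      apply: measurable_bool_EFin
  | |- measurable_fun _ (fun x => (nat_of_bool _)%:R) =>
      apply/measurable_EFinP; apply: measurable_bool_EFin
  | |- measurable_fun _ (fun x => _%:E) => apply/measurable_EFinP
  | |- measurable_fun _ (fun x => _ && _) => apply: measurable_and
  | |- measurable_fun _ (fun x => (_ < _)%R) => apply: measurable_fun_ltr
  | |- measurable_fun _ (fun x => (_ <= _)%R) => apply: measurable_fun_ler
  | |- measurable_fun _ (fun x => (_ *: _)%R) => apply: measurable_scale_rV
  | |- measurable_fun _ (GRing.scale ?c) =>
      apply: (@measurable_scale_rV _ _ _ _ (fun=> c) id)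
  | |- measurable_fun _ (GRing.add ?c) =>
      apply: (@measurable_add_rV _ _ _ _ (fun=> c) id)
  | |- measurable_fun _ (row_mx ?c) =>
      apply: (@measurable_row_mx _ _ _ _ _ (fun=> c) id)
  | |- measurable_fun _ (fun x => row_mx _ _) => apply: measurable_row_mx
  | |- measurable_fun _ (fun x => lsubmx _) => apply: measurable_lsubmx
  | |- measurable_fun _ (fun x => fun_of_matrix (rsubmx _) _ _) =>
      apply: measurable_last_coord
  | |- measurable_fun _ (fun x => enorm _) => apply: measurable_fun_enorm
  | |- measurable_fun _ (@enorm _ _) => exact: measurable_enorm
  | |- measurable_fun _ (@Num.norm _ _) => exact: normr_measurable
  | |- measurable_fun _ (fun x => `|_|%R) => apply: measurable_fun_normr
  | |- measurable_fun _ (fun x => (_ ^+ _)%R) => apply: measurable_funX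
  | |- measurable_fun _ (fun x => (_ * _)%R) => apply: measurable_funM
  | |- measurable_fun _ (fun x => (_ + _)%R) =>
      first [apply: measurable_funD | apply: measurable_add_rV]
  | |- measurable_fun _ (fun x => (_^-1)%R) =>
      apply: measurable_inv_ge0; [by move=> ?; rewrite ?exprn_ge0// ?enorm_ge0|]
  | H : measurable_fun setT ?F |- measurable_fun _ (fun x => ?F _) =>
      apply: (measurableT_comp H)
  end.

Ltac measurability := repeat measurability_step.

Section enorm_theory.
Context {R : realType}.

Lemma enormZ n (a : R) (z : 'rV[R]_n) : enorm (a *: z) = `|a| * enorm z.
Proof.
rewrite /enorm -sqrtr_sqr -sqrtrM ?sqr_ge0//; congr Num.sqrt.
by rewrite mulr_sumr; apply: eq_bigr => i _; rewrite mxE exprMn.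
Qed.

Lemma enorm_sqr n (z : 'rV[R]_n) : enorm z ^+ 2 = \sum_i z ord0 i ^+ 2.
Proof. by rewrite sqr_sqrtr// sumr_ge0// => i _; rewrite sqr_ge0. Qed.

Lemma coord_le_enorm n (z : 'rV[R]_n) i : `|z ord0 i| <= enorm z.
Proof.
rewrite -sqrtr_sqr ler_wsqrtr// (bigD1 i)//= lerDl sumr_ge0// => j _.
by rewrite sqr_ge0.
Qed.

Lemma enorm_row_mx n m (u : 'rV[R]_n) (v : 'rV[R]_m) :
  enorm (row_mx u v) = Num.sqrt (enorm u ^+ 2 + enorm v ^+ 2).
Proof.
rewrite /enorm big_split_ord/= !enorm_sqr; congr (Num.sqrt (_ + _));
  by apply: eq_bigr => i _; rewrite ?row_mxEl ?row_mxEr.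
Qed.

Lemma enorm_scalar1 (s : R) : enorm (s%:M : 'rV[R]_1) = `|s|.
Proof. by rewrite /enorm big_ord1 mxE eqxx sqrtr_sqr. Qed.

Lemma enorm_normalize n (z : 'rV[R]_n) : 0 < enorm z ->
  enorm ((enorm z)^-1 *: z) = 1.
Proof.
move=> z0; rewrite enormZ ger0_norm ?invr_ge0 ?enorm_ge0//.
by rewrite mulVf// gt_eqF.
Qed.

End enorm_theory.

(** * Power integrals on the line *)

Section integral_R.
Context {R : realType}.
Local Notation leb := (@lebesgue_measure R).
Local Open Scope ereal_scope.

Lemma eq_integral_off0 (G H : R -> \bar R) :
  measurable_fun setT G -> measurable_fun setT H ->
  (forall t, 0 <= G t) -> (forall t, 0 <= H t) ->
  (forall t, t != 0%R -> G t = H t) ->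
  \int[leb]_t G t = \int[leb]_t H t.
Proof.
move=> mG mH G0 H0 GH; apply: ge0_ae_eq_integral => //.
exists [set 0%R]; split; [exact: measurable_set1|exact: lebesgue_measure_set1|].
move=> t /= /not_implyP[_ GHt]; apply: contrapT => /eqP t0.
by apply: GHt; exact: GH.
Qed.

(** An antiderivative of [t ^- n.+2] is [- t ^- n.+1 / n.+1], which vanishes at
infinity. *)
Lemma integral_inv_expn_tail n (a : R) : (0 < a)%R ->
  \int[leb]_t ((a <= t)%R%:R * (t ^+ n.+2)^-1)%:E =
  (n.+1%:R^-1 * (a ^+ n.+1)^-1)%:E.
Proof.
move=> a0.
transitivity (\int[leb]_(t in `[a, +oo[) ((t ^+ n.+2)^-1)%:E).
  rewrite [RHS]integral_mkcond epatch_indic; apply: eq_integral => t _ /=.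
  rewrite EFinM muleC; congr (_ * _); rewrite indicE; congr (_%:R%:E).
  case: (leP a t) => at_; first by rewrite mem_set//= in_itv/= at_.
  by rewrite memNset//= in_itv/= leNgt at_.
have gt0 (t : R) : (a <= t -> 0 < t)%R by exact: lt_le_trans.
have derive_inv k (t : R) : (0 < t)%R ->
    is_derive t 1%R (fun y : R => (y ^+ k.+1)^-1)%R
      (- (k.+1%:R * (t ^+ k.+2)^-1))%R.
  move=> t0; have tk j : (t ^+ j != 0)%R by rewrite expf_neq0// gt_eqF.
  have dX : is_derive t 1%R (fun y : R => y ^+ k.+1)%R
      ((k.+1%:R * t ^+ k) *: 1)%R.
    have := @is_deriveX R R (@idfun R) k.+1 t 1%R 1%R (is_derive_id t 1%R).
    by rewrite exprfctE.
  have := @is_deriveV _ (fun y : R => y ^+ k.+1)%R t _ 1%R (tk k.+1) dX.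
  move=> dV; apply: is_derive_eq.
  rewrite scaler1 /GRing.scale/= !(exprS _ k) !(exprS _ k.+1) !(exprS _ k).
  field. by rewrite tk gt_eqF.
pose F (t : R) : R := (- (n.+1%:R^-1 * (t ^+ n.+1)^-1))%R.
have dF (t : R) : (0 < t)%R -> is_derive t 1%R F (t ^+ n.+2)^-1%R.
  move=> t0; have := derive_inv n t t0 => dV.
  have := is_deriveN (is_deriveZ n.+1%:R^-1 dV).
  rewrite scalerN opprK => dF; apply: is_derive_eq.
  by rewrite /GRing.scale/= mulKf ?pnatr_eq0.
rewrite (@ge0_continuous_FTC2y R _ F a 0).
- by rewrite sub0e -EFinN opprK.
- by move=> t /gt0 t0; rewrite invr_ge0 exprn_ge0// ltW.
- apply/continuous_in_subspaceT => t; rewrite inE/= in_itv/= andbT => /gt0 t0.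
  apply: differentiable_continuous; apply/derivable1_diffP.
  by have [] := derive_inv n.+1 t t0.
- rewrite /F -[X in _ --> X]oppr0 -(mulr0 (n.+1%:R^-1 : R)%R).
  apply: cvgN; apply: cvgM; first exact: cvg_cst.
  apply/(@gtr0_cvgV0 R _ _ _ (fun t => t ^+ n.+1)%R).
    by near=> t; apply: exprn_gt0; near: t; exact: nbhs_pinfty_gt.
  apply/cvgryPge => M; near=> t.
  have t1 : (1 <= t)%R by near: t; exact: nbhs_pinfty_ge.
  have : (M <= t)%R by near: t; exact: nbhs_pinfty_ge.
  move=> /le_trans; apply.
  by rewrite exprS ler_peMr ?exprn_ege1// (le_trans _ t1).
- by move=> t at_; have [] := dF t (gt0 _ (ltW at_)).
- apply: cvg_at_right_filter; apply: differentiable_continuous.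
  by apply/derivable1_diffP; have [] := dF a a0.
- move=> t; rewrite in_itv/= andbT => at_.
  by rewrite derive1E; have [_ ->] := dF t (gt0 _ (ltW at_)).
Unshelve. all: by end_near. Qed.


Lemma integral_radial_tail n (a : R) : (0 < a)%R ->
  n.+1%:R%:E * \int[leb]_t ((a <= `|t|)%R%:R * (`|t| ^+ n.+2)^-1)%:E =
  (2 * (a ^+ n.+1)^-1)%:E.
Proof.
move=> a0.
pose g (t : R) : R := ((a <= t)%R%:R * (`|t| ^+ n.+2)^-1)%R.
have g0 t : (0 <= g t)%R by rewrite mulr_ge0 ?invr_ge0 ?exprn_ge0.
have mb : measurable_fun setT (fun t : R => (a <= t)%R%:R%:E : \bar R).
  by apply: measurable_bool_EFin; exact: measurable_fun_ler.
have mg : measurable_fun setT (EFin \o g).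
  apply/measurable_EFinP; apply: measurable_funM; first exact/measurable_EFinP.
  by measurability.
have ig : \int[leb]_t (g t)%:E = (n.+1%:R^-1 * (a ^+ n.+1)^-1)%:E.
  rewrite -integral_inv_expn_tail//; apply: eq_integral => t _; rewrite /g.
  case: (leP a t) => [at_|_]; last by rewrite !mul0r.
  by rewrite ger0_norm// ltW// (lt_le_trans a0).
transitivity (n.+1%:R%:E * \int[leb]_t ((g t)%:E + (g (- t)%R)%:E)).
  congr (_ * _); apply: eq_integral => t _; rewrite -EFinD; congr EFin.
  rewrite /g normrN -mulrDl; congr (_ * _)%R.
  have [t0|t0] := leP 0%R t.
    have ta : (- t < a)%R by rewrite (le_lt_trans _ a0)// oppr_le0.
    by rewrite (leNgt a (- t)%R) ta addr0 ger0_norm.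
  have ta : (t < a)%R by exact: lt_trans a0.
  by rewrite (leNgt a t) ta add0r ltr0_norm.
rewrite ge0_integralD//=; last 3 first.
- by move=> t _; rewrite lee_fin.
- by move=> t _; rewrite lee_fin.
- exact: (measurableT_comp mg).
rewrite [X in (_ + X)%E](_ : _ = \int[leb]_t (g t)%:E); last first.
  rewrite [RHS](@ge0_integral_affine _ (-1) 0 (EFin \o g))
    ?oppr_eq0 ?oner_eq0//.
  rewrite normrN1 mul1e.
  by apply: eq_integral => t _; rewrite /= mulN1r add0r.
rewrite ig -EFinD -EFinM; congr EFin.
by rewrite -mulr2n mulrnAr mulVKf ?pnatr_eq0// mulr_natl.
Qed.

End integral_R.

(** * The surface measure of the sphere *)

Section surface.
Context {R : realType}.
Local Open Scope ereal_scope.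


Lemma measurable_punctured_ball n :
  measurable [set z : 'rV[R]_n | (0 < enorm z <= 1)%R].
Proof.
rewrite -[X in measurable X]setTI.
have mb : measurable_fun setT (fun z : 'rV[R]_n => (0 < enorm z <= 1)%R).
  by measurability.
exact: (mb measurableT [set true]).
Qed.

(** By its definition through cones, the surface measure is n times the image,
under the radial projection, of Lebesgue measure on the punctured unit ball. *)
Lemma integral_surface n (F : 'rV[R]_n -> \bar R) :
  measurable_fun setT F -> (forall z, 0 <= F z) ->
  \int[surface_measure n]_w F w = n%:R%:E * \int[lebesgue_rV n]_z
    ((0 < enorm z <= 1)%R%:R%:E * F ((enorm z)^-1 *: z)%R).
Proof.
move=> mF F0.
pose B := [set z : 'rV[R]_n | (0 < enorm z <= 1)%R].
have mB : measurable B := @measurable_punctured_ball n.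
pose proj (z : 'rV[R]_n) := ((enorm z)^-1 *: z)%R.
have mproj : measurable_fun setT proj := @measurable_normalize R n.
have mFp : measurable_fun setT (F \o proj) by exact: measurableT_comp.
pose nu := mscale (NngNum (ler0n R n))
  (measure_function_pushforward__canonical__measure_function_Measure
    (mrestr (lebesgue_rV n) mB) mproj).
rewrite (eq_measure_integral nu); last first.
  move=> A mA _; rewrite /nu /mscale/= /surface_measure /pushforward /mrestr.
  congr (_ * _); congr (_ _); apply/seteqP.
  by split => z /= [? ?]; split.
rewrite ge0_integral_mscale//= ge0_integral_pushforward//= preimage_setT.
congr (_ * _).
rewrite (@ge0_negligible_integral _ _ _ _ _ (~` B))//=; last first.
- by rewrite /mrestr setICl measure0.
- exact: measurableC.
rewrite setTD setCK (eq_measure_integral (lebesgue_rV n)); last first.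
  by move=> A mA AB; rewrite /= /mrestr setIidl.
rewrite integral_mkcond epatch_indic; apply: eq_integral => z _ /=.
rewrite muleC indicE; congr (_%:R%:E * _); rewrite /B.
case: (boolP (0 < enorm z <= 1)%R) => zB; first by rewrite mem_set.
by rewrite memNset//=; exact/negP.
Qed.

(** The unit ball is contained in the cube [-1, 1]^n. *)
Lemma surface_measureT_lty n : surface_measure n setT < +oo :> \bar R.
Proof.
rewrite /surface_measure lte_mul_pinfty//.
have box : lebesgue_rV n [set z : 'rV[R]_n | forall i, `[(-1)%R, 1%R]%classic
    (z ord0 i)] = (2 ^+ n)%:E.
  apply: lebesgue_rV_box => //; rewrite lebesgue_measure_itv/= lte_fin.
  by rewrite ifT ?opprK; [rewrite -EFinD|lra].
apply: (@le_lt_trans _ _ (2 ^+ n)%:E); last exact: ltry.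
rewrite -box le_measure// ?inE.
  exact: measurable_unit_cone.
  exact: measurable_box.
move=> z [/andP[_ z1] _] i; rewrite /= in_itv/= -ler_norml.
exact: le_trans (coord_le_enorm z i) z1.
Qed.

HB.instance Definition _ n := Measure_isFinite.Build _ _ _
  (@surface_measure R n) (lty_fin_num_fun (surface_measureT_lty n)).

(** In dimension N = n + 1, the cube ]0, 1/N]^N lies in the punctured ball. *)
Lemma surface_measureT_gt0 n : 0 < surface_measure n.+1 setT :> \bar R.
Proof.
rewrite /surface_measure mule_gt0 ?lte_fin//.
pose e : R := n.+1%:R^-1%R.
have e0 : (0 < e)%R by rewrite invr_gt0.
have box : lebesgue_rV n.+1 [set z : 'rV[R]_n.+1 | forall i, `]0%R, e]%classic
    (z ord0 i)] = (e ^+ n.+1)%:E.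
  apply: lebesgue_rV_box => //.
  by rewrite lebesgue_measure_itv/= lte_fin e0 oppr0 adde0.
apply: (@lt_le_trans _ _ (e ^+ n.+1)%:E); first by rewrite lte_fin exprn_gt0.
rewrite -box le_measure// ?inE.
  exact: measurable_box.
  exact: measurable_unit_cone.
move=> z /= ze; split => //.
have z_gt0 i : (0 < z ord0 i)%R by have := ze i; rewrite /= in_itv/= => /andP[].
have z_le i : (z ord0 i <= e)%R by have := ze i; rewrite /= in_itv/= => /andP[].
apply/andP; split.
  rewrite (lt_le_trans (z_gt0 ord0))//.
  by rewrite (le_trans (ler_norm _))// coord_le_enorm.
rewrite -(sqrtr1 R) ler_wsqrtr// (@le_trans _ _ (\sum_(i < n.+1) e)%R)//.
  apply: ler_sum => i _; rewrite expr2 -[leRHS]mulr1.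
  rewrite ler_pM ?(ltW (z_gt0 i))// (le_trans (z_le i))//.
  by rewrite /e invf_le1 ?ler1n.
by rewrite sumr_const card_ord -mulr_natl /e divff.
Qed.

Lemma surface_measure_setC_sphere n :
  surface_measure n (~` sphere n) = 0 :> \bar R.
Proof.
rewrite /surface_measure (_ : unit_cone _ = set0) ?measure0 ?mule0//.
apply/seteqP; split => // z [/andP[z0 _]]; apply.
exact: enorm_normalize.
Qed.

Lemma measurable_sphere n : measurable (@sphere R n).
Proof.
rewrite -[X in measurable X]setTI.
exact: (@measurable_enorm R n measurableT [set 1%R]).
Qed.

End surface.

(** * Polar coordinates *)

Section polar.
Context {R : realType}.
Local Notation leb := (@lebesgue_measure R).
Local Open Scope ereal_scope.

(** Both sides of the origin of the line are integrated over, so that every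
point [t *: w] is reached twice, from [(t, w)] and from [(- t, - w)]: whence the
factor 2. Writing the sphere integral as an integral over the ball, the left
side is a double integral of F (t z / |z|) over t in R and z in the ball. The
substitutions t -> t |z| for fixed z and z -> z / t for fixed t turn it into the
integral of F(z) |z|^(n+1) |t|^-(n+2) over |z| <= |t|, where the integral over t
is an explicit power of |z| that cancels |z|^(n+1). *)
Lemma integral_polar n (F : 'rV[R]_n.+1 -> \bar R) :
  measurable_fun setT F -> (forall z, 0 <= F z) ->
  \int[leb]_t ((`|t| ^+ n)%:E *
    \int[surface_measure n.+1]_w F (t *: w)%R) =
  2%:E * \int[lebesgue_rV n.+1]_z F z.
Proof.
move=> mF F0.
pose b (z : 'rV[R]_n.+1) : R := (0 < enorm z <= 1)%R%:R.
have b0 z : (0 <= b z)%R by [].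
have mb : measurable_fun setT b by rewrite /b; measurability.
pose A (t : R) (z : 'rV[R]_n.+1) : \bar R :=
  (`|t| ^+ n * b z)%:E * F ((t * (enorm z)^-1) *: z)%R.
have A0 t z : 0 <= A t z by rewrite mule_ge0// lee_fin mulr_ge0// exprn_ge0.
have mA : measurable_fun setT (fun p : R * 'rV[R]_n.+1 => A p.1 p.2).
  by rewrite /A; measurability.
transitivity (n.+1%:R%:E * \int[leb]_t \int[lebesgue_rV n.+1]_z A t z).
  rewrite -ge0_integralZl//; last 2 first.
  - exact: measurable_integral2.
  - by move=> t _; exact: integral_ge0.
  apply: eq_integral => t _; rewrite integral_surface//; last first.
    by measurability.
  rewrite muleCA; congr (_ * _); rewrite -ge0_integralZl//; last 2 first.
  - by measurability.
  - by move=> z _; rewrite mule_ge0.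
  by apply: eq_integral => z _; rewrite muleA -EFinM scalerA.
(* The integrand after the substitution t -> t |z|. *)
pose A' (t : R) (z : 'rV[R]_n.+1) : \bar R :=
  (`|t| ^+ n * b z * enorm z ^+ n.+1)%:E * F (t *: z)%R.
have A'0 t z : 0 <= A' t z.
  by rewrite mule_ge0// lee_fin !mulr_ge0// exprn_ge0// enorm_ge0.
have mA' : measurable_fun setT (fun p : R * 'rV[R]_n.+1 => A' p.1 p.2).
  by rewrite /A'; measurability.
transitivity (n.+1%:R%:E * \int[leb]_t \int[lebesgue_rV n.+1]_z A' t z).
  apply: (congr1 (mule _)).
  rewrite (tonelli_lebesgue _ mA A0) (tonelli_lebesgue _ mA' A'0).
  apply: eq_integral => z _.
  have [z0|bz0] := boolP (0 < enorm z <= 1)%R; last first.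
    have {}bz0 : b z = 0%R by rewrite /b (negbTE bz0).
    by rewrite /A /A' bz0 !integral0_eq// => t _; rewrite mulr0 ?mul0r mul0e.
  have {z0} z0 : (enorm z != 0)%R by case/andP: z0 => /lt0r_neq0.
  rewrite (ge0_integral_affine 0 z0)//; last first.
    by rewrite /A; measurability.
  rewrite -ge0_integralZl//; last first.
        by rewrite /A; measurability.
  apply: eq_integral => t _; rewrite add0r /A /A' muleA -EFinM.
  congr (_%:E * F (_ *: _)).
    by rewrite normrM ger0_norm ?enorm_ge0// exprMn exprS; ring.
  by rewrite mulrC mulrA mulVf ?mul1r.
(* The kernel left in front of F after the substitution z -> z / t. *)
pose c (t : R) (z : 'rV[R]_n.+1) : R :=
  ((0 < enorm z)%R%:R * (enorm z <= `|t|)%R%:R *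
   enorm z ^+ n.+1 * (`|t| ^+ n.+2)^-1)%R.
have c0 t z : (0 <= c t z)%R.
  by rewrite !mulr_ge0// ?invr_ge0 exprn_ge0// enorm_ge0.
have cF0 t z : 0 <= (c t z)%:E * F z by rewrite mule_ge0// lee_fin.
have mc : measurable_fun setT
    (fun p : R * 'rV[R]_n.+1 => (c p.1 p.2)%:E * F p.2).
  by rewrite /c; measurability.
transitivity (n.+1%:R%:E *
    \int[leb]_t \int[lebesgue_rV n.+1]_z ((c t z)%:E * F z)).
  apply: (congr1 (mule _)); apply: eq_integral_off0.
  - exact: measurable_integral2.
  - exact: (@measurable_integral2 _ _ _ _ _ _ (fun t z => (c t z)%:E * F z)).
  - by move=> t; exact: integral_ge0.
  - by move=> t; apply: integral_ge0.
  move=> t t0.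
  have tV0 : (t^-1 != 0)%R by rewrite invr_eq0.
  rewrite (integral_scaling tV0)//; last first.
    by rewrite /A'; measurability.
  rewrite -ge0_integralZl//; last first.
    by rewrite /A'; measurability.
  apply: eq_integral => z _; rewrite /A' muleA -EFinM scalerA divff// scale1r.
  congr (_%:E * _); rewrite /b /c enormZ normfV.
  have t_gt0 : (0 < `|t|)%R by rewrite normr_gt0.
  rewrite pmulr_rgt0 ?invr_gt0// ler_pdivrMl// mulr1.
  rewrite -mulnb natrM exprMn !exprVn !exprS; field.
  by rewrite expf_neq0 normr_eq0.
rewrite (tonelli_lebesgue _ mc cF0).
transitivity (\int[lebesgue_rV n.+1]_z (2%:E * ((0 < enorm z)%R%:R%:E * F z))).
  rewrite -ge0_integralZl//; last 2 first.
  - exact: (measurable_integral_lebesgue mc).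
  - by move=> z _; apply: integral_ge0.
  apply: eq_integral => z _.
  have [z0|] := boolP (0 < enorm z)%R; last first.
    move=> z0; rewrite mul0e mule0 integral0_eq ?mule0// => t _.
    by rewrite /c (negbTE z0) !mul0r mul0e.
  transitivity (n.+1%:R%:E * (((enorm z ^+ n.+1)%:E * F z) *
      \int[leb]_t ((enorm z <= `|t|)%R%:R * (`|t| ^+ n.+2)^-1)%:E)).
    congr (_ * _); rewrite -ge0_integralZl//; last 2 first.
    - by measurability.
    - by rewrite mule_ge0// lee_fin exprn_ge0// enorm_ge0.
    apply: eq_integral => t _; rewrite /c z0 mul1r muleAC -EFinM.
    by congr (_%:E * _); ring.
  rewrite muleCA integral_radial_tail// mul1e muleAC -EFinM.
  by congr (_%:E * _); rewrite mulrCA divff ?mulr1// expf_neq0// gt_eqF.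
rewrite ge0_integralZl//; last 2 first.
- by measurability.
- by move=> z _; rewrite mule_ge0.
congr (_ * _); apply: ge0_ae_eq_integral => //.
- by measurability.
- by move=> z _; rewrite mule_ge0.
(* The origin, where the kernel vanishes, lies in a null hyperplane. *)
exists [set z : 'rV[R]_n.+1 | z ord0 ord0 = 0%R]; split.
- rewrite -[X in measurable X]setTI.
  exact: (@measurable_coord R n.+1 ord0 measurableT [set 0%R]).
- exact: lebesgue_rV_hyperplane.
move=> z /= /not_implyP[_ FzE]; apply: contrapT => /eqP z0; apply: FzE.
suff -> : (0 < enorm z)%R by rewrite mul1e.
by rewrite (lt_le_trans _ (coord_le_enorm z ord0))// normr_gt0.
Qed.

End polar.

(** * Cylindrical coordinates and the fibration of the sphere *)

Section cylindrical.
Context {R : realType}.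
Local Notation leb := (@lebesgue_measure R).
Local Open Scope ereal_scope.

Lemma eq_integral_sphere n (G H : 'rV[R]_n -> \bar R) :
  measurable_fun setT G -> measurable_fun setT H ->
  (forall w, 0 <= G w) -> (forall w, 0 <= H w) ->
  (forall w, enorm w = 1%R -> G w = H w) ->
  \int[surface_measure n]_w G w = \int[surface_measure n]_w H w.
Proof.
move=> mG mH G0 H0 GH; apply: ge0_ae_eq_integral => //.
exists (~` sphere n); split.
- by apply: measurableC; exact: measurable_sphere.
- exact: surface_measure_setC_sphere.
- by move=> w /= /not_implyP[_ GHw] w1; apply: GHw; exact: GH.
Qed.

Lemma integral_surface_opp n (F : 'rV[R]_n -> \bar R) :
  measurable_fun setT F -> (forall w, 0 <= F w) ->
  \int[surface_measure n]_w F (- w)%R = \int[surface_measure n]_w F w.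
Proof.
move=> mF F0.
have mFN : measurable_fun setT (fun w : 'rV[R]_n => F (- w)%R).
  rewrite (_ : (fun _ => _) = (fun w : 'rV[R]_n => F (-1 *: w)%R)).
    by measurability.
  by apply/funext => w; rewrite scaleN1r.
rewrite !integral_surface//.
have N1 : (-1 != 0 :> R)%R by rewrite oppr_eq0 oner_eq0.
apply: (congr1 (mule _)); rewrite [RHS](integral_scaling N1); last 2 first.
- by measurability.
- by move=> z; rewrite mule_ge0.
rewrite normrN1 expr1n mul1e; apply: eq_integral => z _.
by rewrite enormZ normrN1 mul1r scalerA mulrN1 scaleNr.
Qed.

Lemma integral_polar_pred n (F : 'rV[R]_n -> \bar R) : (0 < n)%N ->
  measurable_fun setT F -> (forall z, 0 <= F z) ->
  \int[leb]_t ((`|t| ^+ n.-1)%:E * \int[surface_measure n]_w F (t *: w)%R) =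
  2%:E * \int[lebesgue_rV n]_z F z.
Proof. by case: n F => // n F _; exact: integral_polar. Qed.

Lemma surface_measureTE n : (0 < n)%N ->
  exists2 a : R, (0 < a)%R & surface_measure n setT = a%:E.
Proof.
case: n => // n _; exists (fine (surface_measure n.+1 [set: 'rV[R]_n.+1])).
  by apply: fine_gt0; rewrite surface_measureT_gt0 surface_measureT_lty.
by rewrite fineK// ge0_fin_numE// surface_measureT_lty.
Qed.

(** Polar coordinates for the indicator of the punctured ball B: the left side
of the polar formula is the radial integral times |S|, the right side is 2 |B|,
and |S| = n |B|. Hence the positive finite factor |S| cancels. *)
Lemma integral_radial_ball n : (0 < n)%N ->
  n%:R%:E * \int[leb]_t ((0 < `|t| <= 1)%R%:R * `|t| ^+ n.-1)%:E = 2%:E.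
Proof.
move=> n0; have [a a0 aE] := surface_measureTE n0.
have mball : measurable_fun setT
    (fun z : 'rV[R]_n => (0 < enorm z <= 1)%R%:R%:E : \bar R).
  by measurability.
have := integral_polar_pred n0 mball (fun=> ltac:(by rewrite lee_fin)).
have int_cst (r : R) : \int[@surface_measure R n]_w r%:E = (r * a)%:E.
  by rewrite integral_cst// EFinM; apply: (congr1 (mule _)).
have := @integral_surface R n (fun=> 1) (measurable_cst _) (fun=> ltac:(by [])).
rewrite int_cst mul1r.
under eq_integral do rewrite mule1.
set B := (X in _ * X) => aB.
move=> polar.
pose J := \int[leb]_t ((0 < `|t| <= 1)%R%:R * `|t| ^+ n.-1)%:E.
have : J * a%:E = 2%:E * B.
  rewrite -polar /J -ge0_integralZr//; last 2 first.
  - by measurability.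
  - by rewrite lee_fin ltW.
  apply: eq_integral => t _.
  rewrite (@eq_integral_sphere _ _
    (fun=> (0 < `|t| <= 1)%R%:R%:E))//; last 2 first.
  - by measurability.
  - by move=> w w1; rewrite enormZ w1 mulr1.
  by rewrite int_cst -EFinM; congr EFin; ring.
move=> JB; apply/eqP; rewrite eq_le.
by apply/andP; split; rewrite -(@lee_pmul2r _ a%:E)//= -muleA JB muleCA -aB.
Qed.


(** The cylindrical coordinates of R^(n+m) around the axis R^m: in z = (v, s), v
is the position along the axis and s the signed distance to it, and w in S^(n-1)
is the direction of the departure from the axis. *)
Definition cyl n m (z : 'rV[R]_(m + 1)) (w : 'rV[R]_n) : 'rV[R]_(n + m) :=
  row_mx (rsubmx z ord0 ord0 *: w) (lsubmx z).

Lemma cylZ n m (a : R) (z : 'rV[R]_(m + 1)) (w : 'rV[R]_n) :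
  cyl (a *: z) w = (a *: cyl z w)%R.
Proof. by rewrite /cyl scale_row_mx scalerA !linearZ/= mxE. Qed.

Lemma enorm_cyl n m (z : 'rV[R]_(m + 1)) (w : 'rV[R]_n) :
  enorm w = 1%R -> enorm (cyl z w) = enorm z.
Proof.
move=> w1; rewrite /cyl enorm_row_mx enormZ w1 mulr1 -[in RHS](hsubmxK z).
rewrite enorm_row_mx addrC; congr Num.sqrt; congr (_ + _)%R.
by rewrite {2}(mx11_scalar (rsubmx z)) enorm_scalar1.
Qed.

Lemma measurable_cyl d (T : measurableType d) n m (z : T -> 'rV[R]_(m + 1))
    (w : T -> 'rV[R]_n) :
  measurable_fun setT z -> measurable_fun setT w ->
  measurable_fun setT (fun t => cyl (z t) (w t)).
Proof. by move=> mz mw; rewrite /cyl; measurability. Qed.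

(** For fixed v this is the polar formula in the first n coordinates. *)
Lemma integral_cylindrical n m (F : 'rV[R]_(n + m) -> \bar R) : (0 < n)%N ->
  measurable_fun setT F -> (forall z, 0 <= F z) ->
  \int[lebesgue_rV (m + 1)]_z ((`|rsubmx z ord0 ord0| ^+ n.-1)%:E *
    \int[surface_measure n]_w F (cyl z w)) =
  2%:E * \int[lebesgue_rV (n + m)]_z F z.
Proof.
move=> n0 mF F0.
pose A (z : 'rV[R]_(m + 1)) : \bar R := (`|rsubmx z ord0 ord0| ^+ n.-1)%:E *
  \int[surface_measure n]_w F (cyl z w).
have mint : measurable_fun setT (fun z : 'rV[R]_(m + 1) =>
    \int[surface_measure n]_w F (cyl z w)).
  apply: (measurable_integral2 _ (F := fun z w => F (cyl z w))) => //.
  by apply: (measurableT_comp mF); exact: measurable_cyl.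
have mA : measurable_fun setT A by rewrite /A; measurability.
have A0 z : 0 <= A z.
  by rewrite mule_ge0// ?lee_fin ?exprn_ge0//; exact: integral_ge0.
have mFr : measurable_fun setT
    (fun p : 'rV[R]_m * 'rV[R]_n => F (row_mx p.2 p.1)).
  by measurability.
rewrite [LHS](@integral_row_mx R m 1 A)//.
transitivity (\int[lebesgue_rV m]_v
    (2%:E * \int[lebesgue_rV n]_u F (row_mx u v))).
  apply: eq_integral => v _; rewrite integral_rV1//; last first.
    by apply: (measurableT_comp mA); measurability.
  rewrite -(@integral_polar_pred _ (fun u => F (row_mx u v)) n0); last 2 first.
  - by measurability.
  - by move=> u; exact: F0.
  apply: eq_integral => t _.
  rewrite /A row_mxKr mxE eqxx mulr1n; apply: (congr1 (mule _)).
  apply: eq_integral => w _.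
  by rewrite /cyl row_mxKr row_mxKl mxE eqxx mulr1n.
rewrite ge0_integralZl//; last 2 first.
- exact: (measurable_integral2 _ (F := fun v u => F (row_mx u v))).
- by move=> v _; exact: integral_ge0.
apply: (congr1 (mule _)).
rewrite (tonelli _ _ (F := fun v u => F (row_mx u v)))//.
by rewrite -integral_row_mx.
Qed.

(** The heart of the theorem. The map (s, w) |-> cyl s w sends S^m x S^(n-1)
onto S^(n+m-1), because |cyl z w| = |z| for |w| = 1. The formula for its
Jacobian is obtained by integrating the function Fb, which is F(z / |z|) on the
unit ball, in cylindrical coordinates: the result is an integral over the unit
ball of R^(m+1) of a function H which is homogeneous of degree n - 1 there, and
polar coordinates in R^(m+1) reduce it to an integral over S^m. *)
Lemma integral_fibration n m (F : 'rV[R]_(n + m) -> \bar R) : (0 < n)%N ->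
  measurable_fun setT F -> (forall z, 0 <= F z) ->
  \int[surface_measure (m + 1)]_s ((`|rsubmx s ord0 ord0| ^+ n.-1)%:E *
    \int[surface_measure n]_w F (cyl s w)) =
  2%:E * \int[surface_measure (n + m)]_z F z.
Proof.
move=> n0 mF F0.
have nm0 : (0 < n + m)%N by rewrite addn_gt0 n0.
pose K (s : 'rV[R]_(m + 1)) : \bar R := (`|rsubmx s ord0 ord0| ^+ n.-1)%:E *
  \int[surface_measure n]_w F (cyl s w).
have mint : measurable_fun setT (fun z : 'rV[R]_(m + 1) =>
    \int[surface_measure n]_w F (cyl z w)).
  apply: (measurable_integral2 _ (F := fun z w => F (cyl z w))) => //.
  by apply: (measurableT_comp mF); exact: measurable_cyl.
have mK : measurable_fun setT K by rewrite /K; measurability.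
have K0 s : 0 <= K s.
  by rewrite mule_ge0// ?lee_fin ?exprn_ge0//; exact: integral_ge0.
rewrite -[LHS]/(\int[surface_measure (m + 1)]_s K s).
pose B k (z : 'rV[R]_k) : R := (0 < enorm z <= 1)%R%:R.
have B0 k z : 0 <= (@B k z)%:E by rewrite lee_fin.
pose Fb (z : 'rV[R]_(n + m)) := (B _ z)%:E * F ((enorm z)^-1 *: z)%R.
have mFb : measurable_fun setT Fb by rewrite /Fb /B; measurability.
have Fb0 z : 0 <= Fb z by rewrite mule_ge0.
have -> : \int[surface_measure (n + m)]_z F z =
    (n + m)%:R%:E * \int[lebesgue_rV (n + m)]_z Fb z.
  exact: integral_surface.
rewrite muleCA -integral_cylindrical//.
pose H (q : 'rV[R]_(m + 1)) : \bar R :=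
  (B _ q * enorm q ^+ n.-1)%:E * K ((enorm q)^-1 *: q)%R.
have mH : measurable_fun setT H by rewrite /H /B; measurability.
have H0 q : 0 <= H q.
  by rewrite mule_ge0// lee_fin mulr_ge0// exprn_ge0// enorm_ge0.
transitivity ((n + m)%:R%:E * \int[lebesgue_rV (m + 1)]_q H q); last first.
  apply: (congr1 (mule _)); apply: eq_integral => q _.
  rewrite (@eq_integral_sphere _ _ (fun w =>
    (B _ q)%:E * F (cyl ((enorm q)^-1 *: q)%R w)))//; last 4 first.
  - by apply: (measurableT_comp mFb); exact: measurable_cyl.
  - apply: emeasurable_funM => //.
    by apply: (measurableT_comp mF); exact: measurable_cyl.
  - by move=> w; rewrite mule_ge0.
  - by move=> w w1; rewrite /Fb /B enorm_cyl// cylZ.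
  rewrite ge0_integralZl//; last first.
    by apply: (measurableT_comp mF); exact: measurable_cyl.
  rewrite /H /K /B.
  have [/andP[q0 _]|_] := boolP (0 < enorm q <= 1)%R; last first.
    by rewrite !mul0e mule0 mul0r mul0e.
  rewrite !mul1e mul1r muleA -EFinM; congr (_%:E * _).
  rewrite linearZ/= mxE normrM exprMn ger0_norm ?invr_ge0 ?enorm_ge0//.
  by rewrite exprVn mulrA divff ?mul1r// expf_neq0// gt_eqF.
(* J is the radial factor; it carries the homogeneity degree n - 1 of H and the
   weight |t|^m of the polar coordinates of R^(m+1). *)
have m10 : (0 < m + 1)%N by rewrite addn1.
pose J := \int[leb]_t ((0 < `|t| <= 1)%R%:R * `|t| ^+ (n + m).-1)%:E.
have JE : (n + m)%:R%:E * J = 2%:E by exact: integral_radial_ball.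
set IK := \int[surface_measure (m + 1)]_s K s.
have IK0 : 0 <= IK by exact: integral_ge0.
have polar : J * IK = 2%:E * \int[lebesgue_rV (m + 1)]_q H q.
  rewrite -(integral_polar_pred m10 mH H0).
  transitivity (\int[leb]_t
      (((0 < `|t| <= 1)%R%:R * `|t| ^+ (n + m).-1)%:E * IK)).
    rewrite ge0_integralZr//; last first.
      by measurability.
  apply: eq_integral => t _.
  rewrite (@eq_integral_sphere _ _ (fun s =>
    ((0 < `|t| <= 1)%R%:R * `|t| ^+ n.-1)%:E *
    K ((t / `|t|) *: s)%R))//; last 4 first.
  - by measurability.
  - by measurability.
  - by move=> s; rewrite mule_ge0// lee_fin mulr_ge0// exprn_ge0.
  - by move=> s s1; rewrite /H /B enormZ s1 mulr1 scalerA [(_^-1 * t)%R]mulrC.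
  rewrite ge0_integralZl//; last first.
    by measurability.
  have [/andP[t0 _]|_] := boolP (0 < `|t| <= 1)%R; last first.
    by rewrite ![(0 * _)%R]mul0r [LHS]mul0e [X in _ * X]mul0e [RHS]mule0.
  rewrite ![(1 * _)%R]mul1r muleA -EFinM -exprD.
  have -> : ((m + 1).-1 + n.-1)%N = (n + m).-1.
    rewrite [(m + 1).-1](congr1 predn (addn1 m))/=.
    by rewrite -subn1 addnBA// subn1 addnC.
  apply: (congr1 (mule _)).
  (* The remaining factor t / |t| is a sign, and S^m is symmetric. *)
  move: (t0); rewrite normr_gt0 neq_lt => /orP[tn|tp].
  - have -> : (t / `|t| = -1)%R.
      by rewrite (ltr0_norm tn) invrN mulrN divff ?lt_eqF.
    rewrite /IK -(integral_surface_opp mK K0).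
    by apply: eq_integral => s _; rewrite scaleN1r.
  - have -> : (t / `|t| = 1)%R by rewrite (gtr0_norm tp) divff ?gt_eqF.
    by apply: eq_integral => s _; rewrite scale1r.
have two0 : (0 < 2%:E :> \bar R) by rewrite lte_fin.
have E : 2%:E * ((n + m)%:R%:E * \int[lebesgue_rV (m + 1)]_q H q) = 2%:E * IK.
  by rewrite muleCA -polar muleA JE.
apply/eqP; rewrite eq_le.
by apply/andP; split; rewrite -(@lee_pmul2l _ 2%:E)//= E.
Qed.

End cylindrical.

(** * Integrals of functions that are only almost everywhere measurable *)

Section nonmeasurable_integral.
Context {d : measure_display} {T : measurableType d} {R : realType}.
Variable mu : {measure set T -> \bar R}.
Local Open Scope ereal_scope.
Import HBNNSimple.

Let nnintegral (f : T -> \bar R) := ereal_sup [set sintegral mu h |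
  h in [set h : {nnsfun T >-> R} | forall x, (h x)%:E <= f x]].

(** A simple function below f is, once set to zero on the null set N, below g,
and its integral is unchanged. *)
Lemma nnintegral_le_off_null (N : set T) (f g : T -> \bar R) :
  measurable N -> mu N = 0 -> (forall x, 0 <= g x) ->
  (forall x, ~ N x -> f x = g x) -> nnintegral f <= nnintegral g.
Proof.
move=> mN N0 g0 fg; apply: ub_ereal_sup => _ [h hf <-].
pose h' := proj_nnsfun h (measurableC mN).
have -> : sintegral mu h = sintegral mu h'.
  rewrite -!integralT_nnsfun; apply: ge0_ae_eq_integral => //.
  - exact/measurable_EFinP.
  - exact/measurable_EFinP.
  - by move=> x _; rewrite lee_fin.
  - by move=> x _; rewrite lee_fin.
  exists N; split => // x /= /not_implyP[_ hx].
  apply: contrapT => Nx; apply: hx.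
  by rewrite /= mindicE mem_set// mulr1.
apply: ereal_sup_ubound; exists h' => //= x; rewrite mindicE.
have [Nx|Nx] := pselect (N x).
  by rewrite memNset ?mulr0//= => /(_ Nx).
by rewrite mem_set// mulr1 -fg.
Qed.

(** Since the integral is a difference of suprema over simple functions, it
depends only on the class of f modulo null sets, even for nonmeasurable f. *)
Lemma integral_ae_representative (D : set T) (f g : T -> \bar R) :
  {ae mu, forall x, (f \_ D) x = g x} ->
  \int[mu]_(x in D) f x = \int[mu]_x g x.
Proof.
case=> N [mN N0 fgN]; rewrite /integral patch_setT.
have fg x : ~ N x -> (f \_ D) x = g x.
  by move=> Nx; apply: contrapT => fgx; apply: Nx; exact: fgN.
have le_nn (u v : T -> \bar R) : (forall x, 0 <= v x) ->
    (forall x, ~ N x -> u x = v x) -> nnintegral u <= nnintegral v.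
  exact: nnintegral_le_off_null.
congr (_ - _); apply/eqP; rewrite eq_le; apply/andP; split; apply: le_nn => //;
  by move=> x Nx; rewrite ?funeposE ?funenegE fg.
Qed.

End nonmeasurable_integral.

(** * Almost every slice of an integrable function is integrable *)

(** The common form of the polar, cylindrical and fibration formulas: Phi
parametrizes X by T x W with Jacobian [wt], and the factor 2 counts the two
parameters of each point. *)
Definition disintegrates {dX dT dW : measure_display} {X : measurableType dX}
    {T : measurableType dT} {W : measurableType dW} {R : realType}
    (mu : {measure set X -> \bar R}) (nu : {measure set T -> \bar R})
    (kappa : {measure set W -> \bar R}) (Phi : T -> W -> X) (wt : T -> R) :=
  forall G : X -> \bar R, measurable_fun setT G -> (forall x, 0 <= G x)%E ->
  (\int[nu]_t ((wt t)%:E * \int[kappa]_w G (Phi t w)) =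
   2%:E * \int[mu]_x G x)%E.

Section slicing.
Context {dX dT dW : measure_display} {X : measurableType dX}
  {T : measurableType dT} {W : measurableType dW} {R : realType}.
Variables (mu : {measure set X -> \bar R}) (nu : {measure set T -> \bar R})
  (kappa : {sigma_finite_measure set W -> \bar R})
  (Phi : T -> W -> X) (wt : T -> R).
Hypotheses (mPhi : measurable_fun setT (fun p : T * W => Phi p.1 p.2))
  (mwt : measurable_fun setT wt) (wt0 : forall t, 0 <= wt t)
  (slices : disintegrates mu nu kappa Phi wt).
Local Open Scope ereal_scope.

Lemma measurable_slice t : measurable_fun setT (Phi t).
Proof. exact: (measurableT_comp mPhi (measurable_pair1 t)). Qed.

Lemma measurable_slice_integral (G : X -> \bar R) :
  measurable_fun setT G -> (forall x, 0 <= G x) ->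
  measurable_fun setT (fun t => \int[kappa]_w G (Phi t w)).
Proof.
move=> mG G0.
apply: (measurable_integral2 _ (F := fun t w => G (Phi t w))) => //.
exact: measurableT_comp.
Qed.

Lemma measurable_weighted_slice (G : X -> \bar R) :
  measurable_fun setT G -> (forall x, 0 <= G x) ->
  measurable_fun setT (fun t => (wt t)%:E * \int[kappa]_w G (Phi t w)).
Proof.
move=> mG G0; apply: emeasurable_funM; first exact/measurable_EFinP.
exact: measurable_slice_integral.
Qed.

Lemma weighted_slice_ge0 (G : X -> \bar R) t : (forall x, 0 <= G x) ->
  0 <= (wt t)%:E * \int[kappa]_w G (Phi t w).
Proof. by move=> G0; rewrite mule_ge0 ?lee_fin//; exact: integral_ge0. Qed.

Lemma integrable_weighted_slice (G : X -> \bar R) :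
  measurable_fun setT G -> (forall x, 0 <= G x) -> \int[mu]_x G x < +oo ->
  nu.-integrable setT (fun t => (wt t)%:E * \int[kappa]_w G (Phi t w)).
Proof.
move=> mG G0 Goo; apply/integrableP; split.
  exact: measurable_weighted_slice.
under eq_integral do rewrite gee0_abs ?weighted_slice_ge0//.
by rewrite slices// lte_mul_pinfty// lee_fin.
Qed.

Lemma ae_slice_lty (G : X -> \bar R) :
  measurable_fun setT G -> (forall x, 0 <= G x) -> \int[mu]_x G x < +oo ->
  {ae nu, forall t, wt t != 0%R -> \int[kappa]_w G (Phi t w) < +oo}.
Proof.
move=> mG G0 Goo.
have := integrable_ae measurableT (integrable_weighted_slice mG G0 Goo).
apply: filterS => t /(_ Logic.I) fin wt_neq0.
rewrite ltey; apply/eqP => slice_oo; move: fin.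
by rewrite slice_oo mulry gtr0_sg ?lt0r ?wt_neq0 ?wt0// mul1e.
Qed.

(** For a null set N containing the exceptions, the weighted integral of the
slice measures of N is 2 mu(N) = 0. *)
Lemma ae_slice_ae (P : set X) : {ae mu, forall x, P x} ->
  {ae nu, forall t, wt t != 0%R -> {ae kappa, forall w, P (Phi t w)}}.
Proof.
case=> N [mN N0 PN].
pose G x : \bar R := (\1_N x)%:E.
have mG : measurable_fun setT G by exact/measurable_EFinP.
have G0 x : 0 <= G x by rewrite lee_fin.
have := slices mG G0; rewrite integral_indic// setIT N0 mule0 => slice0.
have : \int[nu]_t `|(wt t)%:E * \int[kappa]_w G (Phi t w)| = 0.
  rewrite -[RHS]slice0; apply: eq_integral => t _.
  by rewrite gee0_abs// weighted_slice_ge0.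
move/(ae_eq_integral_abs _ measurableT (measurable_weighted_slice mG G0)).
apply: filterS => t /(_ Logic.I) /= /eqP; rewrite mule_eq0 eqe => /orP[->//|].
move=> /eqP GPhi0 _.
have mNt : measurable (Phi t @^-1` N).
  rewrite -[X in measurable X]setTI.
  exact: measurable_slice.
exists (Phi t @^-1` N); split => //; last by move=> w /= Pw; exact: PN.
by rewrite -(setIT (Phi t @^-1` N)) -integral_indic.
Qed.

End slicing.

(** * Integrability on spheres *)

Section sphere_integrability.
Context {R : realType}.

Lemma ae_sphere n : {ae @surface_measure R n, forall w, sphere n w}.
Proof.
exists (~` sphere n); split => //.
- by apply: measurableC; exact: measurable_sphere.
- exact: surface_measure_setC_sphere.
Qed.

Lemma ae_integrable_sphere n (F : 'rV[R]_n -> R) :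
  ae_integrable (surface_measure n) (sphere n) F <->
  ae_integrable (surface_measure n) setT F.
Proof.
split=> -[g ig Fg].
  exists (g \_ (sphere n)).
    rewrite -restrict_EFin.
    exact: ((integrable_mkcond (EFin \o g) (@measurable_sphere R n)).1 ig).
  have sph := ae_sphere n.
  apply: filterS2 sph Fg => w w1 Fgw _.
  by rewrite patchE mem_set// Fgw.
exists g; last by apply: filterS Fg => w /(_ Logic.I).
by apply: integrableS ig => //; exact: measurable_sphere.
Qed.

Lemma Rintegral_sphere_representative n (F g : 'rV[R]_n -> R) :
  {ae surface_measure n, forall w, F w = g w} ->
  \int[surface_measure n]_(w in sphere n) F w = \int[surface_measure n]_w g w.
Proof.
move=> Fg; congr fine; apply: integral_ae_representative.
have sph := ae_sphere n.
by apply: filterS2 sph Fg => w w1 Fgw; rewrite patchE mem_set//= Fgw.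
Qed.

Lemma ae_integrableZl n (a : R) (F : 'rV[R]_n -> R) :
  ae_integrable (surface_measure n) (sphere n) F ->
  ae_integrable (surface_measure n) (sphere n) (fun w => a * F w).
Proof.
move=> [g ig Fg]; exists (fun w => a * g w).
  rewrite (_ : EFin \o _ = (fun w => a%:E * (EFin \o g) w)%E)//.
  by apply: integrableZl => //; exact: measurable_sphere.
by apply: filterS Fg => w Fgw /Fgw ->.
Qed.

Lemma Rintegral_sphereZl n (a : R) (F : 'rV[R]_n -> R) :
  ae_integrable (surface_measure n) (sphere n) F ->
  \int[surface_measure n]_(w in sphere n) (a * F w) =
  a * \int[surface_measure n]_(w in sphere n) F w.
Proof.
move=> /ae_integrable_sphere[g ig Fg].
rewrite (@Rintegral_sphere_representative _ F g); last first.
  by apply: filterS Fg => w /(_ Logic.I).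
rewrite (@Rintegral_sphere_representative _ _ (fun w => a * g w)).
  by rewrite RintegralZl.
by apply: filterS Fg => w /(_ Logic.I) ->.
Qed.

Lemma sphere_area_gt0 n : (0 < n)%N -> 0 < sphere_area n :> R.
Proof.
move=> n0; have [a a0 aE] := @surface_measureTE R n n0.
suff sE : surface_measure n (@sphere R n) = a%:E by rewrite /sphere_area sE.
rewrite -aE -(setUv (sphere n)) measureU//; last 3 first.
- exact: measurable_sphere.
- by apply: measurableC; exact: measurable_sphere.
- by rewrite setICr.
by rewrite [X in (_ + X)%E]surface_measure_setC_sphere adde0.
Qed.

End sphere_integrability.

(** * Slices of locally integrable functions *)

Section locally_integrable_slices.
Context {R : realType} {N n : nat} {d : measure_display}
  {T : measurableType d}.
Variables (nu : {measure set T -> \bar R})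
  (Phi : T -> 'rV[R]_n -> 'rV[R]_N) (wt : T -> R).
Hypotheses
  (mPhi : measurable_fun setT (fun p : T * 'rV[R]_n => Phi p.1 p.2))
  (mwt : measurable_fun setT wt) (wt0 : forall t, 0 <= wt t)
  (slices : disintegrates (lebesgue_rV N) nu (surface_measure n) Phi wt)
  (bounded_slices : forall t, exists k : nat, forall w, enorm w = 1 ->
    forall i, `|Phi t w ord0 i| <= k%:R).

(** Local integrability is used through the truncations G k of |g| to the cubes
[-k, k]^N, whose integrals are finite. Each slice is bounded, so that |g|
agrees with some G k on it. *)
Lemma L1loc_slice (f : 'rV[R]_N -> R) : L1loc f ->
  {ae nu, forall t, wt t != 0 ->
    ae_integrable (surface_measure n) (sphere n) (fun w => f (Phi t w))}.
Proof.
move=> [g [mg gloc] fg].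
pose box (k : nat) :=
  [set z : 'rV[R]_N | forall i, `[- k%:R, k%:R]%classic (z ord0 i)].
have mbox k : measurable (box k) by exact: measurable_box.
pose G k x : \bar R := (`|g x| * \1_(box k) x)%:E.
have mG k : measurable_fun setT (G k).
  apply/measurable_EFinP; apply: measurable_funM.
    exact: measurable_fun_normr.
  exact: measurable_indic.
have G0 k x : (0 <= G k x)%E by rewrite lee_fin mulr_ge0.
have Goo k : (\int[lebesgue_rV N]_x G k x < +oo)%E.
  have cbox : compact (box k).
    apply: (@rV_compact R N (fun=> `[- k%:R, k%:R]%classic)) => i.
    exact: segment_compact.
  have := gloc _ cbox; rewrite integral_mkcond epatch_indic.
  by under eq_integral do rewrite /= -EFinM.
have slice_fin : {ae nu, forall t, forall k, wt t != 0 ->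
    (\int[surface_measure n]_w G k (Phi t w) < +oo)%E}.
  by apply: ae_foralln => k; exact: (ae_slice_lty mPhi mwt wt0 slices).
have slice_ae := ae_slice_ae mPhi mwt wt0 slices fg.
apply: filterS2 slice_fin slice_ae => t fin aet wt_neq0.
apply/ae_integrable_sphere; exists (fun w => g (Phi t w)); last first.
  by apply: filterS (aet wt_neq0) => w.
have mgt : measurable_fun setT (fun w => g (Phi t w)).
  by apply: (measurableT_comp mg); exact: measurable_slice.
apply/integrableP; split; first exact/measurable_EFinP.
have [k kP] := bounded_slices t.
rewrite (@eq_integral_sphere _ _ _ (fun w => G k (Phi t w))).
- exact: fin.
- by apply/measurable_EFinP; exact: measurable_fun_normr.
- by apply: (measurableT_comp (mG k)); exact: measurable_slice.
- by move=> w; exact: abse_ge0.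
- by [].
move=> w w1; rewrite /G indicE mem_set ?mulr1// => i.
by rewrite /= in_itv/= -ler_norml kP.
Qed.

End locally_integrable_slices.

(** * The disintegrations of R^N and of the sphere *)

Section disintegrations.
Context {R : realType}.
Local Notation leb := (@lebesgue_measure R).

Lemma disintegrates_polar N (c : 'rV[R]_N) : (0 < N)%N ->
  disintegrates (lebesgue_rV N) leb (surface_measure N)
    (fun t w => c + t *: w) (fun t : R => `|t| ^+ N.-1).
Proof.
move=> N0 G mG G0; rewrite -(integral_translation c)//.
by rewrite -integral_polar_pred//; measurability.
Qed.

Lemma disintegrates_cylindrical n m (c : 'rV[R]_(n + m)) : (0 < n)%N ->
  disintegrates (lebesgue_rV (n + m)) (lebesgue_rV (m + 1)) (surface_measure n)
    (fun z w => c + cyl z w)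
    (fun z : 'rV[R]_(m + 1) => `|rsubmx z ord0 ord0| ^+ n.-1).
Proof.
move=> n0 G mG G0; rewrite -(integral_translation c)//.
by rewrite -integral_cylindrical//; measurability.
Qed.

Lemma disintegrates_sphere n m : (0 < n)%N ->
  disintegrates (surface_measure (n + m)) (surface_measure (m + 1))
    (surface_measure n) (fun z w => @cyl R n m z w)
    (fun s : 'rV[R]_(m + 1) => `|rsubmx s ord0 ord0| ^+ n.-1).
Proof. by move=> n0 G mG G0; exact: integral_fibration. Qed.

Lemma L1loc_ae_sphere N (f : 'rV[R]_N -> R) (c : 'rV[R]_N) : (0 < N)%N ->
  L1loc f -> {ae leb, forall r, r != 0 ->
    ae_integrable (surface_measure N) (sphere N) (fun w => f (c + r *: w))}.
Proof.
move=> N0 Lf.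
have mPhi : measurable_fun setT
    (fun p : measurableTypeR R * 'rV[R]_N => c + (p.1 : R) *: p.2).
  by measurability.
have mwt : measurable_fun setT (fun t : measurableTypeR R => `|t| ^+ N.-1).
  by measurability.
have wt0 (t : R) : 0 <= `|t| ^+ N.-1 by rewrite exprn_ge0.
have := L1loc_slice mPhi mwt wt0 (disintegrates_polar c N0) _ Lf.
have bounded t : exists k : nat, forall w : 'rV[R]_N, enorm w = 1 ->
    forall i, `|(c + t *: w) ord0 i| <= k%:R.
  exists (Num.bound (enorm c + `|t|)) => w w1 i.
  apply: le_trans (ltW (archi_boundP _)); last by rewrite addr_ge0// enorm_ge0.
  rewrite !mxE (le_trans (ler_normD _ _))// lerD ?coord_le_enorm// normrM.
  by rewrite ler_piMr// -w1 coord_le_enorm.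
move=> /(_ bounded); apply: filterS => r + r0; apply.
by rewrite expf_neq0// normr_eq0.
Qed.

Lemma last_coord_neq0_ae m :
  {ae lebesgue_rV (m + 1), forall z : 'rV[R]_(m + 1), rsubmx z ord0 ord0 != 0}.
Proof.
have mN : measurable [set z : 'rV[R]_(m + 1) | rsubmx z ord0 ord0 = 0].
  rewrite -[X in measurable X]setTI.
  have ms : measurable_fun setT (fun z : 'rV[R]_(m + 1) => rsubmx z ord0 ord0).
    by measurability.
  exact: (ms measurableT [set 0]).
exists [set z : 'rV[R]_(m + 1) | rsubmx z ord0 ord0 = 0].
split => //; last first.
  by move=> z /= /negP; rewrite negbK => /eqP.
have mind : measurable_fun setT (fun z : 'rV[R]_(m + 1) =>
    (\1_[set z : 'rV[R]_(m + 1) | rsubmx z ord0 ord0 = 0] z)%:E : \bar R).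
  exact/measurable_EFinP/measurable_indic.
rewrite -(setIT [set z | _]) -integral_indic// integral_row_mx//.
apply: integral0_eq => v _.
have mrow : measurable_fun setT (fun q : 'rV[R]_1 => row_mx v q).
  by measurability.
rewrite integral_rV1//; last exact: (measurableT_comp mind mrow).
rewrite (@eq_integral_off0 R _ (fun=> 0%E))//.
- by rewrite integral0.
- apply: (measurableT_comp mind (measurableT_comp mrow _)).
  exact: measurable_scalar_rV1.
move=> t t0; rewrite indicE memNset//= row_mxKr mxE eqxx mulr1n.
exact/eqP.
Qed.

Lemma L1loc_ae_cylindrical n m (f : 'rV[R]_(n + m) -> R) (c : 'rV[R]_(n + m)) :
  (0 < n)%N -> L1loc f ->
  {ae lebesgue_rV (m + 1), forall z : 'rV[R]_(m + 1),
    ae_integrable (surface_measure n) (sphere n) (fun w => f (c + cyl z w))}.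
Proof.
move=> n0 Lf.
have mPhi : measurable_fun setT
    (fun p : 'rV[R]_(m + 1) * 'rV[R]_n => c + cyl p.1 p.2).
  by apply: measurable_add_rV => //; exact: measurable_cyl.
have mwt : measurable_fun setT
    (fun z : 'rV[R]_(m + 1) => `|rsubmx z ord0 ord0| ^+ n.-1).
  by measurability.
have wt0 (z : 'rV[R]_(m + 1)) : 0 <= `|rsubmx z ord0 ord0| ^+ n.-1.
  by rewrite exprn_ge0.
have := L1loc_slice mPhi mwt wt0 (disintegrates_cylindrical c n0) _ Lf.
have bounded z : exists k : nat, forall w : 'rV[R]_n, enorm w = 1 ->
    forall i, `|(c + cyl z w) ord0 i| <= k%:R.
  exists (Num.bound (enorm c + enorm z)) => w w1 i.
  apply: le_trans (ltW (archi_boundP _)); last by rewrite addr_ge0// enorm_ge0.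
  rewrite mxE (le_trans (ler_normD _ _))// lerD ?coord_le_enorm//.
  by rewrite -(enorm_cyl z w1) coord_le_enorm.
move=> /(_ bounded); apply: filterS2 (last_coord_neq0_ae m) => z z0; apply.
by rewrite expf_neq0// normr_eq0.
Qed.

End disintegrations.

(** * The fibration of the sphere for integrable functions *)

Lemma integrable_fine {d : measure_display} {T : measurableType d}
    {R : realType} (mu : {measure set T -> \bar R}) (P : T -> \bar R) :
  (forall t, 0 <= P t)%E -> mu.-integrable setT P ->
  mu.-integrable setT (EFin \o (fine \o P)) /\
  \int[mu]_t fine (P t) = fine (\int[mu]_t P t)%E.
Proof.
move=> P0 iP; have mP := measurable_int _ iP.
have mfP : measurable_fun setT (EFin \o (fine \o P)).
  apply/measurable_EFinP.
  exact: (measurableT_comp (@fine_measurable R _ measurableT)).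
have fP0 t : (0 <= (fine (P t))%:E)%E by rewrite lee_fin fine_ge0.
split.
  apply: le_integrable iP => // t _; rewrite (gee0_abs (fP0 t)) gee0_abs//.
  by case: (P t) (P0 t) => [r _|_|//]; rewrite ?leey.
congr fine; apply: ge0_ae_eq_integral => //.
apply: filterS (integrable_ae measurableT iP) => t fin _ /=.
by rewrite fineK// fin.
Qed.

Section sphere_fibration.
Context {R : realType}.

(** The nonnegative formula is applied to the positive and negative parts of a
measurable representative g of F. On almost every fibre both parts have a finite
integral and F agrees with g, so that the inner integral of F is a difference of
real numbers. *)
Lemma Rintegral_fibration n m (F : 'rV[R]_(n + m) -> R) : (0 < n)%N ->
  ae_integrable (surface_measure (n + m)) (sphere (n + m)) F ->
  let K (s : 'rV[R]_(m + 1)) := `|rsubmx s ord0 ord0| ^+ n.-1 *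
    \int[surface_measure n]_(w in sphere n) F (cyl s w) in
  ae_integrable (surface_measure (m + 1)) (sphere (m + 1)) K /\
  \int[surface_measure (m + 1)]_(s in sphere (m + 1)) K s =
  2 * \int[surface_measure (n + m)]_(z in sphere (n + m)) F z.
Proof.
move=> n0 /ae_integrable_sphere[g ig Fg] K.
have {}Fg : {ae surface_measure (n + m), forall z, F z = g z}.
  by apply: filterS Fg => z /(_ Logic.I).
pose wt (s : 'rV[R]_(m + 1)) : R := `|rsubmx s ord0 ord0| ^+ n.-1.
have wt0 s : 0 <= wt s by rewrite exprn_ge0.
have mwt : measurable_fun setT wt by rewrite /wt; measurability.
have mcyl : measurable_fun setT
    (fun p : 'rV[R]_(m + 1) * 'rV[R]_n => cyl p.1 p.2).
  exact: measurable_cyl.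
have slices := @disintegrates_sphere R n m n0.
pose gE : 'rV[R]_(n + m) -> \bar R := EFin \o g.
have mgE : measurable_fun setT gE := measurable_int _ ig.
pose P s := ((wt s)%:E * \int[surface_measure n]_w gE^\+ (cyl s w))%E.
pose Q s := ((wt s)%:E * \int[surface_measure n]_w gE^\- (cyl s w))%E.
have mgp := measurable_funepos mgE.
have mgn := measurable_funeneg mgE.
have gp_fin := integral_funepos_lt_pinfty measurableT ig.
have gn_fin := integral_funeneg_lt_pinfty measurableT ig.
have P0 s : (0 <= P s)%E.
  by apply: weighted_slice_ge0 => // z; exact: funepos_ge0.
have Q0 s : (0 <= Q s)%E.
  by apply: weighted_slice_ge0 => // z; exact: funeneg_ge0.
have [ifP intP] := integrable_fine P0
  (integrable_weighted_slice mcyl mwt wt0 slices mgp (funepos_ge0 gE) gp_fin).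
have [ifQ intQ] := integrable_fine Q0
  (integrable_weighted_slice mcyl mwt wt0 slices mgn (funeneg_ge0 gE) gn_fin).
pose k s := fine (P s) - fine (Q s).
have Kk : {ae surface_measure (m + 1), forall s, K s = k s}.
  have p_fin := ae_slice_lty mcyl mwt wt0 slices mgp (funepos_ge0 gE) gp_fin.
  have q_fin := ae_slice_lty mcyl mwt wt0 slices mgn (funeneg_ge0 gE) gn_fin.
  have Fcyl := ae_slice_ae mcyl mwt wt0 slices Fg.
  apply: filterS3 p_fin q_fin Fcyl => s ps qs Fs.
  (* Where the weight vanishes nothing is known about the fibre, but K and k are
     both zero there. *)
  rewrite /K /k /P /Q -/(wt s); have [->|wts] := eqVneq (wt s) 0.
    by rewrite mul0r !mul0e subrr.
  have p_fin_num : (\int[surface_measure n]_w gE^\+ (cyl s w))%E \is a fin_num.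
    by rewrite ge0_fin_numE ?ps// integral_ge0.
  have q_fin_num : (\int[surface_measure n]_w gE^\- (cyl s w))%E \is a fin_num.
    by rewrite ge0_fin_numE ?qs// integral_ge0.
  rewrite !fineM// -mulrBr -fineB//; congr (_ * _).
  rewrite (@Rintegral_sphere_representative _ _ _ (fun w => g (cyl s w)));
    last exact: Fs.
  congr fine; rewrite integralE; congr (_ - _)%E.
    by apply: eq_integral => w _; rewrite !funeposE.
  by apply: eq_integral => w _; rewrite !funenegE.
split.
  apply/ae_integrable_sphere; exists k; last by apply: filterS Kk.
  rewrite (_ : EFin \o k = (EFin \o (fine \o P)) \- (EFin \o (fine \o Q)))%E//.
  exact: integrableB.
rewrite (Rintegral_sphere_representative Kk) RintegralB// intP intQ.
rewrite (slices _ mgp (funepos_ge0 gE)) (slices _ mgn (funeneg_ge0 gE)).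
rewrite (Rintegral_sphere_representative Fg) /Rintegral [in RHS]integralE.
have gp_num : (\int[surface_measure (n + m)]_z gE^\+ z)%E \is a fin_num.
  by rewrite ge0_fin_numE// integral_ge0.
have gn_num : (\int[surface_measure (n + m)]_z gE^\- z)%E \is a fin_num.
  by rewrite ge0_fin_numE// integral_ge0.
by rewrite !fineM// -mulrBr -fineB.
Qed.

End sphere_fibration.

(** * The factorization theorem *)

Theorem theorem2p3 (R : realType) (n m : nat) (hn : (2 <= n)%N)
    (Gamma : set 'rV[R]_n) (hGamma : smooth_hypersurface Gamma)
    (f : 'rV[R]_(n + m) -> R) (hf : L1loc f) (x : 'rV[R]_n) (hx : Gamma x) :
  let h := fun (x : 'rV[R]_n) (y : 'rV[R]_m) (s : R) =>
    `|s| ^+ (n - 1) * Mx f x y s in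
  {ae lebesgue_rV (m + 1), forall z : 'rV[R]_(m + 1),
    Mx_defined f x (lsubmx z) (rsubmx z ord0 ord0)} /\
  forall y : 'rV[R]_m, {ae (@lebesgue_measure R), forall r : R,
    [/\ Mxy_defined f x y r, Mys_defined h x y r &
        Mxy f x y r = Cnm R n m * `|r| ^ (1 - n%:Z) * Mys h x y r]}.
Proof.
move=> h; have n0 : (0 < n)%N by exact: ltnW.
have nm0 : (0 < n + m)%N by rewrite addn_gt0 n0.
split.
  apply: filterS (L1loc_ae_cylindrical (row_mx x 0) n0 hf) => z.
  rewrite /Mx_defined; congr ae_integrable; apply/funext => w.
  by rewrite /Mx_integrand /cyl add_row_mx add0r.
move=> y.
(* For almost every r, r is nonzero and f is integrable on the sphere of radius
   |r| about (x, y); the rest is an identity for this fixed r. *)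
have r_neq0 : {ae @lebesgue_measure R, forall r : R, r != 0}.
  exists [set 0]; split => //; first exact: lebesgue_measure_set1.
  by move=> r /= /negP; rewrite negbK => /eqP.
have := L1loc_ae_sphere (row_mx x y) nm0 hf.
apply: (@filterS2 _ _ (ae_filter_ringOfSetsType (@lebesgue_measure R)) _ _ _ _
  r_neq0) => r r0 /(_ r0) iF.
have [iK intK] := Rintegral_fibration n0 iF.
set K := fun s : 'rV[R]_(m + 1) => _ in iK intK.
(* In direction w, the point of the fibre over (y, 0) + r s is
   (x, y) + r cyl s w. *)
have hK : Mys_integrand h x y r =
    fun s => (`|r| ^+ n.-1 * (sphere_area n)^-1) * K s.
  apply/funext => s; rewrite /Mys_integrand /h /Mx /K.
  have -> : rsubmx (row_mx y 0 + r *: s) ord0 ord0 = r * rsubmx s ord0 ord0.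
    by rewrite linearD linearZ/= row_mxKr add0r mxE.
  rewrite linearD linearZ/= row_mxKl normrM exprMn subn1.
  rewrite mulrACA; congr (_ * _ * _).
  congr (_ * _); apply: eq_Rintegral => w _.
  rewrite /Mx_integrand; congr f.
  by rewrite /cyl scale_row_mx add_row_mx scalerA.
have A0 k : (0 < k)%N -> sphere_area k != 0 :> R.
  by move=> k0; rewrite gt_eqF// sphere_area_gt0.
split; first exact: iF.
  by rewrite /Mys_defined hK; exact: ae_integrableZl.
rewrite /Mxy /Mys hK Rintegral_sphereZl// intK /Cnm.
have -> : `|r| ^ (1 - n%:Z) = (`|r| ^+ n.-1)^-1.
  by rewrite exprnN -subn1 -subzn// opprB.
have An := A0 _ n0.
have Am : sphere_area (m + 1) != 0 :> R by rewrite A0// addn1.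
have rn : `|r| ^+ n.-1 != 0 by rewrite expf_neq0// normr_eq0.
rewrite /Mxy_integrand.
set I := Rintegral _ _ _.
by field; rewrite An Am rn A0.
Qed.
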